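(* Let $J\ge1$ and let initial data $(x^0_{j+1/2})$, $(c^0_j)$, $(\rho_j^0)$, $(u^0_{j+1/2})$ satisfy $$x^0_{-1/2}<x^0_{1/2}<\dots<x^0_{J-1/2},\qquad 0<\underline{c^0}=\min_{0\le j\le J-1}c_j^0\le\overline{c^0}=\max_{0\le j\le J-1}c_j^0<\infty,$$ $$0<\underline{\rho^0}=\min_{0\le j\le J-1}\rho_j^0\le\overline{\rho^0}=\max_{0\le j\le J-1}\rho_j^0<\infty,\qquad \sum_{j=0}^{J-1}|u^0_{j+1/2}|^2\Delta x_j^0+\sum_{j=0}^{J-1}\left|\frac{u^0_{j+1/2}-u^0_{j-1/2}}{\Delta x_j^0}\right|^2\Delta x_j^0<\infty .$$ Then the $J$-periodic system of ODEs $$\begin{cases}\dot x_{j+1/2}=u_{j+1/2},\qquad \dot c_j=0,\qquad \frac{d}{dt}(\rho_j\Delta x_j)=0,\\[1mm] \rho_{j+1/2}\Delta x_{j+1/2}\,\dot u_{j+1/2}+p_{j+1}-p_j=\mu(c_{j+1})\dfrac{u_{j+3/2}-u_{j+1/2}}{\Delta x_{j+1}}-\mu(c_j)\dfrac{u_{j+1/2}-u_{j-1/2}}{\Delta x_j},\end{cases}$$ (notation in the context) with these initial data admits a unique (global in time) solution. Moreover the following hold for all $t\ge0$, uniformly in $J$: $$\frac1{C^1_{ini}(t)}\le\rho_j(t)\le C^1_{ini}(t),\qquad \frac{1}{C^2_{ini}(t)}\Delta x_j^0\le\Delta x_j(t)\le C^2_{ini}(t)\,\Delta x_j^0,\qquad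 \underline{c^0}\le c_j(t)\le\overline{c^0}\qquad(0\le j\le J-1),$$ $$M(t)=M(0),\qquad E(t)=E(0),$$ where $C^1_{ini}$, $C^2_{ini}$ are strictly positive increasing continuous functions that depend only on the initial data (through $\underline{c^0},\overline{c^0},\underline{\rho^0},\overline{\rho^0}$ and the value of the discrete $H^1$ sum above) and not otherwise on $J$, and $$M(t)=\sum_{j=0}^{J-1}\rho_j(t)\Delta x_j(t),$$ $$E(t)=\frac12\sum_{j=0}^{J-1}\rho_{j+1/2}|u_{j+1/2}|^2\Delta x_{j+1/2}(t)+\sum_{j=0}^{J-1}H(\rho_j(t),c_j(t))\Delta x_j(t)+\int_0^t\sum_{j=0}^{J-1}\mu(c_j)\left|\frac{u_{j+1/2}-u_{j-1/2}}{\Delta x_j}\right|^2\Delta x_j\,d\tau .$$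
   Context: All sequences are indexed by $j\in\mathbb Z$ with periodic convention $c_{j+J}=c_j$, $\rho_{j+J}=\rho_j$, $u_{j+J+1/2}=u_{j+1/2}$ and $x_{j+J+1/2}=x_{j+1/2}+1$ (problem posed on the torus of length 1); in particular $x^0_{J-1/2}=x^0_{-1/2}+1$. The dot is $d/dt$. Notation: $\Delta x_j=x_{j+1/2}-x_{j-1/2}$, $\Delta x_{j+1/2}=\frac{\Delta x_j+\Delta x_{j+1}}2$, $\rho_{j+1/2}=\frac{\rho_j\Delta x_j+\rho_{j+1}\Delta x_{j+1}}{\Delta x_j+\Delta x_{j+1}}$, $p_j=p(\rho_j,c_j)$; a superscript $0$ denotes the value at $t=0$. A solution is required to satisfy $x_{-1/2}(t)<x_{1/2}(t)<\dots<x_{J-1/2}(t)$. Pressure and viscosity: $p=p(\rho,c)$ and $\mu=\mu(c)$ are smooth functions for $\rho\ge0$ and $c$ in an interval containing all values $c_j^0$, with $p\ge0$, $\mu\ge\mu_{\min}>0$, $p(\rho,c)\le C_0(\rho+H(\rho,c))$ for some constant $C_0>0$ and $\rho\,\partial_\rho p$ locally bounded, where $H(\rho,c)=\rho\int_1^\rho\frac{p(s,c)}{s^2}ds$. *)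

(* Defs.v *)
From Stdlib Require Import Reals RList List ZArith Lia Lra.
From Coquelicot Require Import Coquelicot.
Open Scope R_scope.

(* Encoding.  A sequence is a function on Z.  A cell quantity a_j is [a j];
   an interface quantity a_{j+1/2} is also written [a j], so that a_{j-1/2}
   is [a (j - 1)].  Time-dependent sequences take the time first. *)

(* [has_deriv_on D f t l]: l is the derivative of f at t relative to the domain
   D (hence one-sided at an end point of D). *)
Definition has_deriv_on (D : R -> Prop) (f : R -> R) (t l : R) : Prop :=
  D_in f (fun _ => l) D t.

(* Smoothness up to the boundary: there is a family of all iterated partial
   derivatives, relative to the domain, and each of them is continuous. *)
Definition smooth1_on (B : R -> Prop) (f : R -> R) : Prop :=
  exists F : nat -> R -> R,
    (forall y, B y -> F 0%nat y = f y) /\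
    (forall k, continuous_on B (F k)) /\
    (forall k y, B y -> has_deriv_on B (F k) y (F (S k) y)).

Definition smooth2_on (A B : R -> Prop) (f : R -> R -> R) : Prop :=
  exists F : nat -> nat -> R -> R -> R,
    (forall x y, A x -> B y -> F 0%nat 0%nat x y = f x y) /\
    (forall k l, continuous_on (fun q : R * R => A (fst q) /\ B (snd q))
                               (fun q : R * R => F k l (fst q) (snd q))) /\
    (forall k l x y, A x -> B y ->
       has_deriv_on A (fun x' => F k l x' y) x (F (S k) l x y) /\
       has_deriv_on B (fun y' => F k l x y') y (F k (S l) x y)).

Definition is_interval (I : R -> Prop) : Prop :=
  forall a b y, I a -> I b -> a <= y <= b -> I y.

Definition H (p : R -> R -> R) (rho c : R) : R :=
  rho * RInt (fun s => p s c / s ^ 2) 1 rho.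

Record constitutive_laws (I : R -> Prop) (p : R -> R -> R) (mu : R -> R)
    : Prop := {
  laws_interval : is_interval I;
  laws_p_smooth : smooth2_on (fun rho => 0 <= rho) I p;
  laws_mu_smooth : smooth1_on I mu;
  laws_p_nonneg : forall rho c, 0 <= rho -> I c -> 0 <= p rho c;
  laws_mu_lower : exists mu_min, 0 < mu_min /\ forall c, I c -> mu_min <= mu c;
  (* Required for rho > 0 only: the integrand of H is singular at s = 0. *)
  laws_p_energy : exists C0, 0 < C0 /\
    forall rho c, 0 < rho -> I c -> p rho c <= C0 * (rho + H p rho c);
  (* The two-sided [Derive] is only relevant for rho > 0; at rho = 0 it is
     multiplied by 0. *)
  laws_dp_locally_bounded : forall rho0 c0, 0 <= rho0 -> I c0 ->
    exists eps B, 0 < eps /\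
      forall rho c, 0 <= rho -> I c ->
        Rabs (rho - rho0) < eps -> Rabs (c - c0) < eps ->
        Rabs (rho * Derive (fun r => p r c) rho) <= B
}.

Definition periodic (J : nat) (a : Z -> R) : Prop :=
  forall j, a (j + Z.of_nat J)%Z = a j.

(* Positions on the torus of length 1, lifted to the line. *)
Definition periodic_lift (J : nat) (x : Z -> R) : Prop :=
  forall j, x (j + Z.of_nat J)%Z = x j + 1.

Definition ordered (J : nat) (x : Z -> R) : Prop :=
  forall j, (0 <= j < Z.of_nat J)%Z -> x (j - 1)%Z < x j.

(* Sum, minimum and maximum over 0 <= j <= J - 1, for 1 <= J. *)
Definition sumJ (J : nat) (a : Z -> R) : R :=
  sum_f_R0 (fun k => a (Z.of_nat k)) (J - 1).

Definition minJ (J : nat) (a : Z -> R) : R :=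
  MinRlist (map (fun k => a (Z.of_nat k)) (seq 0 J)).

Definition maxJ (J : nat) (a : Z -> R) : R :=
  MaxRlist (map (fun k => a (Z.of_nat k)) (seq 0 J)).

(* Delta x_j *)
Definition dx (x : Z -> R) (j : Z) : R := x j - x (j - 1)%Z.

(* Delta x_{j+1/2} *)
Definition dxh (x : Z -> R) (j : Z) : R := (dx x j + dx x (j + 1)) / 2.

(* rho_{j+1/2} *)
Definition rhoh (x rho : Z -> R) (j : Z) : R :=
  (rho j * dx x j + rho (j + 1)%Z * dx x (j + 1)) / (dx x j + dx x (j + 1)).

(* (u_{j+1/2} - u_{j-1/2}) / Delta x_j *)
Definition Du (x u : Z -> R) (j : Z) : R := (u j - u (j - 1)%Z) / dx x j.

Definition discrete_H1 (J : nat) (x u : Z -> R) : R :=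
  sumJ J (fun j => u j ^ 2 * dx x j) + sumJ J (fun j => Du x u j ^ 2 * dx x j).

Record initial_data (J : nat) (x0 c0 rho0 u0 : Z -> R) : Prop := {
  init_x : periodic_lift J x0;
  init_c : periodic J c0;
  init_rho : periodic J rho0;
  init_u : periodic J u0;
  init_ordered : ordered J x0;
  init_c_pos : 0 < minJ J c0;
  init_rho_pos : 0 < minJ J rho0
}.

(* The time interval [0, T), where T may be p_infty. *)
Definition time_dom (T : Rbar) (t : R) : Prop := 0 <= t /\ Rbar_lt t T.

Record is_solution (p : R -> R -> R) (mu : R -> R) (J : nat)
    (x0 c0 rho0 u0 : Z -> R) (T : Rbar) (x c rho u : R -> Z -> R) : Prop := {
  sol_init : forall j,
    x 0 j = x0 j /\ c 0 j = c0 j /\ rho 0 j = rho0 j /\ u 0 j = u0 j;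
  sol_periodic : forall t, time_dom T t ->
    periodic_lift J (x t) /\ periodic J (c t) /\
    periodic J (rho t) /\ periodic J (u t);
  sol_ordered : forall t, time_dom T t -> ordered J (x t);
  sol_x : forall t j, time_dom T t ->
    has_deriv_on (time_dom T) (fun s => x s j) t (u t j);
  sol_c : forall t j, time_dom T t ->
    has_deriv_on (time_dom T) (fun s => c s j) t 0;
  sol_mass : forall t j, time_dom T t ->
    has_deriv_on (time_dom T) (fun s => rho s j * dx (x s) j) t 0;
  sol_momentum : forall t j, time_dom T t ->
    exists du, has_deriv_on (time_dom T) (fun s => u s j) t du /\
      rhoh (x t) (rho t) j * dxh (x t) j * du
        + p (rho t (j + 1)%Z) (c t (j + 1)%Z) - p (rho t j) (c t j)
      = mu (c t (j + 1)%Z) * Du (x t) (u t) (j + 1)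
        - mu (c t j) * Du (x t) (u t) j
}.

Definition mass (J : nat) (x rho : R -> Z -> R) (t : R) : R :=
  sumJ J (fun j => rho t j * dx (x t) j).

Definition energy (p : R -> R -> R) (mu : R -> R) (J : nat)
    (x c rho u : R -> Z -> R) (t : R) : R :=
  / 2 * sumJ J (fun j => rhoh (x t) (rho t) j * u t j ^ 2 * dxh (x t) j)
  + sumJ J (fun j => H p (rho t j) (c t j) * dx (x t) j)
  + RInt (fun s => sumJ J (fun j =>
            mu (c s j) * Du (x s) (u s) j ^ 2 * dx (x s) j)) 0 t.

(* Strictly positive, increasing, continuous functions on [0, +oo). *)
Definition control_function (C : R -> R) : Prop :=
  (forall t, 0 <= t -> 0 < C t) /\
  (forall s t, 0 <= s -> s < t -> C s < C t) /\
  continuous_on (fun t => 0 <= t) C.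

(* Main.v *)
Require Import Defs.
From Stdlib Require Import Reals RList List ZArith Lia Lra Classical ClassicalEpsilon.
From Coquelicot Require Import Coquelicot.
Open Scope R_scope.

(** In Lagrangian form the masses [m_j = rho_j dx_j] and the concentrations are
    constant in time, so the system is a second-order system for the interfaces:
    with the stress [s_j = nu_j Du_j - p_j] of a cell and the mass [mh_j] carried
    by an interface, [mh_j u_j' = s_(j+1) - s_j] ([accel], [motion]).  It is
    singular only where a cell collapses, so everything rests on bounds for the
    density.

    Energy.  Summation by parts gives the energy identity ([is_derive_energy]).
    Since [0 <= p <= C0 (rho + H)], the potential energy plus the mass is
    nonnegative and bounds the total pressure ([total_pressure_le]), so the
    kinetic energy, the total pressure and the time integral of the dissipation
    are bounded by the initial energy and the mass ([energy_controls]).  The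
    discrete H1 norm bounds the initial velocity uniformly
    ([velocity_le_discrete_H1]), hence the initial energy ([initial_energy_le]).

    Density.  As [Du_j = - (ln rho_j)'], the momentum equation summed from cell 0
    to cell [j] and averaged over the torus says that
    [psi_j = nu_j ln rho_j + W_j - mean W], with [W_j] the partial sum of the
    momentum, satisfies [psi_j' = - p_j + source] ([is_derive_effective]), where
    the source is bounded by a constant plus a multiple of the dissipation
    ([effective_source_le]).  The [W_j] are bounded by the energy.  Because
    [p_j >= 0] this bounds [ln rho_j] from above; because [p_j] is bounded while
    [rho_j <= 1], a barrier argument bounds it from below ([log_density_le]).
    Both bounds are affine in time and independent of the number of cells, so
    [C1] and [C2] can be taken to be exponentials of affine functions.  The bounds
    on [dx_j] follow from [rho_j dx_j = m_j].

    Existence and uniqueness.  Clamping the velocities and bounding the cell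
    widths from below makes the field bounded and globally Lipschitz, so the
    truncated system has global solutions ([picard]).  On a bounded time interval
    the bounds above keep the solution in the interior of a large enough box, by
    continuous induction, so that it solves the original system
    ([motion_exists]).  Conversely, on a compact time interval any two solutions
    lie in a common box, where both solve the same truncated system; so they
    agree ([motion_on_unique]), and the solutions on [[0, n]] can be glued
    ([global_motion]). *)


(** * Derivatives relative to a time interval *)

Lemma is_derive_eq (f : R -> R) (t l l' : R) :
  is_derive f t l -> l = l' -> is_derive f t l'.
Proof. intros h e; now rewrite <- e. Qed.

Lemma is_derive_Rmult (f g : R -> R) (t f' g' : R) :
  is_derive f t f' -> is_derive g t g' ->
  is_derive (fun s => f s * g s) t (f' * g t + f t * g').
Proof.
  intros hf hg.
  exact (is_derive_mult f g t f' g' hf hg Rmult_comm).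
Qed.

Lemma is_derive_Rplus (f g : R -> R) (t f' g' : R) :
  is_derive f t f' -> is_derive g t g' ->
  is_derive (fun s => f s + g s) t (f' + g').
Proof. intros hf hg. exact (is_derive_plus f g t f' g' hf hg). Qed.

Lemma is_derive_Rminus (f g : R -> R) (t f' g' : R) :
  is_derive f t f' -> is_derive g t g' ->
  is_derive (fun s => f s - g s) t (f' - g').
Proof. intros hf hg. exact (is_derive_minus f g t f' g' hf hg). Qed.

Lemma is_derive_Rconst (a t : R) : is_derive (fun _ : R => a) t 0.
Proof. exact (is_derive_const a t). Qed.

Lemma is_derive_Rscal (a : R) (f : R -> R) (t f' : R) :
  is_derive f t f' -> is_derive (fun s => a * f s) t (a * f').
Proof. intros hf. exact (is_derive_scal f t a f' hf). Qed.

Lemma is_derive_Rid (t : R) : is_derive (fun s : R => s) t 1.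
Proof. exact (is_derive_id t). Qed.

Lemma is_derive_Rcomp (f g : R -> R) (t f' g' : R) :
  is_derive f (g t) f' -> is_derive g t g' ->
  is_derive (fun s => f (g s)) t (f' * g').
Proof.
  intros hf hg.
  apply (is_derive_eq _ _ (g' * f')); [|ring].
  exact (is_derive_comp f g t f' g' hf hg).
Qed.

Lemma is_derive_continuous (f : R -> R) (t l : R) :
  is_derive f t l -> continuous f t.
Proof. exact (fun h => ex_derive_continuous f t (ex_intro _ l h)). Qed.

Lemma has_deriv_on_eps (D : R -> Prop) (f : R -> R) (t l : R) :
  has_deriv_on D f t l <->
  forall eps, 0 < eps -> exists alp, 0 < alp /\ forall s, D s -> s <> t ->
    Rabs (s - t) < alp -> Rabs ((f s - f t) / (s - t) - l) < eps.
Proof.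
  unfold has_deriv_on, D_in, limit1_in, limit_in; simpl; unfold Rdist, D_x; split.
  - intros h eps he. destruct (h eps he) as [a [ha h1]]. exists a; split; [lra|].
    intros s hD hs hst. apply h1. repeat split; auto.
  - intros h eps he. destruct (h eps he) as [a [ha h1]]. exists a; split; [lra|].
    intros s [[hD hs] hst]. apply h1; auto.
Qed.

Lemma is_derive_has_deriv_on (D : R -> Prop) (f : R -> R) (t l : R) :
  is_derive f t l -> has_deriv_on D f t l.
Proof.
  intros h. apply is_derive_Reals in h. apply has_deriv_on_eps. intros eps he.
  destruct (h eps he) as [d hd]. exists d; split; [apply cond_pos|].
  intros s _ hs hst. specialize (hd (s - t)).
  replace (t + (s - t)) with s in hd by ring. apply hd; auto; lra.
Qed.

Lemma has_deriv_on_is_derive (D : R -> Prop) (f : R -> R) (t l : R) :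
  locally t D -> has_deriv_on D f t l -> is_derive f t l.
Proof.
  intros [r hr] h. apply is_derive_Reals. intros eps he.
  destruct (proj1 (has_deriv_on_eps D f t l) h eps he) as [a [ha h1]].
  assert (hm : 0 < Rmin a r) by (apply Rmin_pos; [lra|apply cond_pos]).
  exists (mkposreal _ hm). simpl. intros k hk0 hk.
  pose proof (Rmin_l a r). pose proof (Rmin_r a r).
  replace k with (t + k - t) at 2 by ring. apply h1.
  - apply hr. change (Rabs (t + k - t) < r). replace (t + k - t) with k by ring. lra.
  - lra.
  - replace (t + k - t) with k by ring. lra.
Qed.

(** Relative derivatives are local: only the values near [t] inside the
    domain matter, so a solution may be assembled from solutions on
    overlapping time intervals. *)
Lemma has_deriv_on_local (D D' : R -> Prop) (f g : R -> R) (t l r : R) :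
  0 < r -> (forall s, D s -> Rabs (s - t) < r -> D' s /\ f s = g s) -> f t = g t ->
  has_deriv_on D' g t l -> has_deriv_on D f t l.
Proof.
  intros hr hl e h. apply has_deriv_on_eps. intros eps he.
  destruct (proj1 (has_deriv_on_eps _ _ _ _) h eps he) as [a [ha h1]].
  exists (Rmin a r). split; [now apply Rmin_pos|]. intros s hD hs hst.
  pose proof (Rmin_l a r). pose proof (Rmin_r a r).
  destruct (hl s hD) as [hD' e']; [lra|]. rewrite e, e'. apply h1; auto; lra.
Qed.

Lemma has_deriv_on_minus (D : R -> Prop) (f g : R -> R) (t l k : R) :
  has_deriv_on D f t l -> has_deriv_on D g t k ->
  has_deriv_on D (fun s => f s - g s) t (l - k).
Proof.
  intros hf hg. apply has_deriv_on_eps. intros eps he.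
  destruct (proj1 (has_deriv_on_eps _ _ _ _) hf (eps / 2)) as [a [ha h1]]; [lra|].
  destruct (proj1 (has_deriv_on_eps _ _ _ _) hg (eps / 2)) as [b [hb h2]]; [lra|].
  exists (Rmin a b). split; [now apply Rmin_pos|]. intros s hD hs hst.
  pose proof (Rmin_l a b). pose proof (Rmin_r a b).
  specialize (h1 s hD hs ltac:(lra)). specialize (h2 s hD hs ltac:(lra)).
  replace ((f s - g s - (f t - g t)) / (s - t) - (l - k)) with
    (((f s - f t) / (s - t) - l) - ((g s - g t) / (s - t) - k)) by (field; lra).
  eapply Rle_lt_trans; [apply Rabs_triang|]. rewrite Rabs_Ropp. lra.
Qed.

Lemma has_deriv_on_continuous_at (D : R -> Prop) (f : R -> R) (t l : R) :
  has_deriv_on D f t l ->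
  forall eps, 0 < eps -> exists alp, 0 < alp /\ forall s, D s ->
    Rabs (s - t) < alp -> Rabs (f s - f t) < eps.
Proof.
  intros h eps he.
  destruct (proj1 (has_deriv_on_eps _ _ _ _) h 1) as [a [ha h1]]; [lra|].
  pose proof (Rabs_pos l) as hl.
  assert (hq : 0 < eps / (2 + Rabs l)) by (apply Rdiv_lt_0_compat; lra).
  exists (Rmin a (eps / (2 + Rabs l))). split; [now apply Rmin_pos|].
  intros s hD hs. pose proof (Rmin_l a (eps / (2 + Rabs l))).
  pose proof (Rmin_r a (eps / (2 + Rabs l))).
  destruct (Req_dec s t) as [->|hne]; [rewrite Rminus_diag, Rabs_R0; lra|].
  specialize (h1 s hD hne ltac:(lra)).
  replace (f s - f t) with ((((f s - f t) / (s - t) - l) + l) * (s - t)) by (field; lra).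
  rewrite Rabs_mult.
  assert (Rabs ((f s - f t) / (s - t) - l + l) <= 1 + Rabs l).
  { eapply Rle_trans; [apply Rabs_triang|]. lra. }
  assert (0 < Rabs (s - t)) by (apply Rabs_pos_lt; lra).
  apply Rle_lt_trans with ((1 + Rabs l) * Rabs (s - t)).
  { apply Rmult_le_compat_r; lra. }
  apply Rlt_le_trans with ((2 + Rabs l) * (eps / (2 + Rabs l))).
  { apply Rmult_le_0_lt_compat; lra. }
  right; field; lra.
Qed.

Definition clamp (a b s : R) : R := Rmax a (Rmin b s).

Lemma clamp_bounds (a b s : R) : a <= b -> a <= clamp a b s <= b.
Proof. unfold clamp, Rmax, Rmin; intros; repeat destruct Rle_dec; lra. Qed.

Lemma clamp_id (a b s : R) : a <= s <= b -> clamp a b s = s.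
Proof. unfold clamp, Rmax, Rmin; intros; repeat destruct Rle_dec; lra. Qed.

Lemma clamp_lipschitz (a b s t : R) : Rabs (clamp a b s - clamp a b t) <= Rabs (s - t).
Proof.
  unfold clamp, Rmax, Rmin, Rabs; repeat destruct Rle_dec; repeat destruct Rcase_abs; lra.
Qed.

Lemma continuous_eps (f : R -> R) (t : R) :
  (forall eps, 0 < eps -> exists alp, 0 < alp /\ forall s,
    Rabs (s - t) < alp -> Rabs (f s - f t) < eps) -> continuous f t.
Proof.
  intros h. apply continuity_pt_filterlim. intros eps he.
  destruct (h eps he) as [a [ha h1]]. exists a; split; [lra|].
  intros s [_ hs]. now apply h1.
Qed.

Lemma continuous_eps_inv (f : R -> R) (t : R) :
  continuous f t ->
  forall eps, 0 < eps -> exists alp, 0 < alp /\ forall s,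
    Rabs (s - t) < alp -> Rabs (f s - f t) < eps.
Proof.
  intros h eps he. apply continuity_pt_filterlim in h.
  destruct (h eps he) as [a [ha h1]]. exists a; split; [lra|].
  intros s hs. destruct (Req_dec s t) as [->|hne].
  - rewrite Rminus_diag, Rabs_R0; lra.
  - apply h1. repeat split; auto.
Qed.

(** Composing with the clamp turns continuity relative to [[0, b]] into
    continuity on the line. *)
Lemma clamp_continuous (b : R) (D : R -> Prop) (f : R -> R) :
  0 <= b -> (forall t, 0 <= t <= b -> D t) ->
  (forall t, 0 <= t <= b -> exists l, has_deriv_on D f t l) ->
  forall t, continuous (fun s => f (clamp 0 b s)) t.
Proof.
  intros hb hD hf t. apply continuous_eps. intros eps he.
  destruct (hf (clamp 0 b t)) as [l hl]; [now apply clamp_bounds|].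
  destruct (has_deriv_on_continuous_at _ _ _ _ hl eps he) as [a [ha h1]].
  exists a; split; [lra|]. intros s hs. apply h1.
  - apply hD. now apply clamp_bounds.
  - eapply Rle_lt_trans; [apply clamp_lipschitz|]. lra.
Qed.

Lemma has_deriv_on_bounded (b : R) (D : R -> Prop) (f : R -> R) :
  0 <= b -> (forall t, 0 <= t <= b -> D t) ->
  (forall t, 0 <= t <= b -> exists l, has_deriv_on D f t l) ->
  exists t1 t2, 0 <= t1 <= b /\ 0 <= t2 <= b /\
    forall t, 0 <= t <= b -> f t1 <= f t <= f t2.
Proof.
  intros hb hD hf.
  assert (hc : forall c, 0 <= c <= b -> continuity_pt (fun s => f (clamp 0 b s)) c).
  { intros c _. apply continuity_pt_filterlim. now apply (clamp_continuous b D). }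
  destruct (continuity_ab_min _ 0 b hb hc) as [t1 [h1 b1]].
  destruct (continuity_ab_maj _ 0 b hb hc) as [t2 [h2 b2]].
  exists t1, t2. split; [easy|split; [easy|]]. intros t ht.
  specialize (h1 t ht). specialize (h2 t ht).
  rewrite !clamp_id in h1 by lra. rewrite !clamp_id in h2 by lra. lra.
Qed.

Lemma nonincreasing_of_derive (f f' : R -> R) (a b : R) :
  a <= b -> (forall t, a < t < b -> is_derive f t (f' t) /\ f' t <= 0) ->
  (forall t, a <= t <= b -> continuous f t) -> f b <= f a.
Proof.
  intros hab hd hc.
  destruct (MVT_gen f a b (fun t => Rmin (f' t) 0)) as [c [_ e]].
  - intros t. rewrite Rmin_left, Rmax_right by lra. intros ht.
    destruct (hd t ht) as [h1 h2]. now rewrite Rmin_left.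
  - intros t. rewrite Rmin_left, Rmax_right by lra. intros ht.
    apply continuity_pt_filterlim. now apply hc.
  - pose proof (Rmin_r (f' c) 0). nra.
Qed.

Lemma nonincreasing_of_has_deriv_on (D : R -> Prop) (f f' : R -> R) (b : R) :
  0 <= b -> (forall t, 0 <= t <= b -> D t) ->
  (forall t, 0 <= t <= b -> has_deriv_on D f t (f' t) /\ f' t <= 0) -> f b <= f 0.
Proof.
  intros hb hD hd.
  assert (h : f (clamp 0 b b) <= f (clamp 0 b 0)).
  { apply (nonincreasing_of_derive (fun s => f (clamp 0 b s)) f' 0 b hb).
    - intros t ht. destruct (hd t) as [h1 h2]; [lra|]. split; [|easy].
      assert (hm : 0 < Rmin t (b - t)) by (apply Rmin_pos; lra).
      pose proof (Rmin_l t (b - t)). pose proof (Rmin_r t (b - t)).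
      assert (hl : forall s, Rabs (s - t) < Rmin t (b - t) -> 0 <= s <= b).
      { intros s hs. apply Rabs_lt_between in hs. lra. }
      apply (is_derive_ext_loc f).
      + exists (mkposreal _ hm). intros s hs. rewrite clamp_id; [easy|]. now apply hl.
      + apply (has_deriv_on_is_derive D); [|easy].
        exists (mkposreal _ hm). intros s hs. apply hD. now apply hl.
    - intros t _. apply (clamp_continuous b D); auto. intros s hs.
      exists (f' s). now apply hd. }
  rewrite !clamp_id in h by lra. exact h.
Qed.

Lemma constant_of_has_deriv_on (D : R -> Prop) (f : R -> R) (b : R) :
  0 <= b -> (forall t, 0 <= t <= b -> D t) ->
  (forall t, 0 <= t <= b -> has_deriv_on D f t 0) -> f b = f 0.
Proof.
  intros hb hD hd. apply Rle_antisym.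
  - apply (nonincreasing_of_has_deriv_on D f (fun _ => 0) b hb hD).
    intros t ht; split; [now apply hd|lra].
  - enough (0 - f b <= 0 - f 0) by lra.
    apply (nonincreasing_of_has_deriv_on D (fun s => 0 - f s) (fun _ => 0) b hb hD).
    intros t ht; split; [|lra].
    pose proof (has_deriv_on_minus D (fun _ => 0) f t 0 0
      (is_derive_has_deriv_on _ _ _ _ (is_derive_Rconst 0 t)) (hd t ht)) as h.
    now rewrite Rminus_0_r in h.
Qed.

Lemma nondecreasing_of_is_derive (f f' : R -> R) (a b : R) :
  a <= b -> (forall t, a <= t <= b -> is_derive f t (f' t)) ->
  (forall t, a < t < b -> 0 <= f' t) -> f a <= f b.
Proof.
  intros hab hd hp.
  enough (- f b <= - f a) by lra.
  apply (nonincreasing_of_derive (fun s => - f s) (fun s => - f' s) a b hab).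
  - intros t ht. split; [|specialize (hp t ht); lra].
    apply (is_derive_opp f t). apply hd; lra.
  - intros t ht. apply (is_derive_continuous _ _ (- f' t)).
    apply (is_derive_opp f t). now apply hd.
Qed.

(** A function that can only decrease above the level [theta] never crosses
    it: after the last time at which the level is attained the function would
    have to increase. *)
Lemma barrier (f f' : R -> R) (theta b : R) :
  0 <= b -> (forall t, 0 <= t <= b -> is_derive f t (f' t)) ->
  theta <= f 0 -> (forall t, 0 <= t <= b -> f t < theta -> 0 <= f' t) ->
  theta <= f b.
Proof.
  intros hb hd h0 hbar. destruct (Rle_lt_dec theta (f b)) as [|hlt]; [easy|exfalso].
  set (E := fun s => 0 <= s <= b /\ theta <= f s).
  destruct (completeness E) as [s [hub hlub]].
  - exists b. intros s [h _]. lra.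
  - exists 0. split; lra.
  - assert (hs0 : 0 <= s) by (apply hub; split; lra).
    assert (hsb : s <= b) by (apply hlub; intros r [hr _]; lra).
    assert (hfs : theta <= f s).
    { destruct (Rle_lt_dec theta (f s)) as [|hl]; [easy|exfalso].
      destruct (continuous_eps_inv f s) with (eps := theta - f s) as [a [ha h]]; [|lra|].
      { apply (is_derive_continuous _ _ (f' s)), hd; lra. }
      enough (s <= s - a) by lra. apply hlub. intros r [hr1 hr2].
      assert (r <= s) by (now apply hub).
      destruct (Rle_lt_dec r (s - a)) as [|hr]; [easy|exfalso].
      assert (hrs : Rabs (r - s) < a) by (apply Rabs_def1; lra).
      specialize (h r hrs). apply Rabs_def2 in h. lra. }
    enough (f s <= f b) by lra.
    apply (nondecreasing_of_is_derive f f' s b hsb).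
    + intros t ht. apply hd; lra.
    + intros t ht. apply hbar; [lra|]. apply Rnot_le_lt. intros hc.
      enough (t <= s) by lra. apply hub. split; [lra|easy].
Qed.

Lemma continuous_induction (P : R -> Prop) (b : R) :
  (forall t, 0 <= t <= b -> (forall s, 0 <= s < t -> P s) ->
    exists eps, 0 < eps /\ forall s, t <= s < t + eps -> P s) ->
  forall t, 0 <= t <= b -> P t.
Proof.
  intros hstep t0 ht0. apply NNPP. intros hP.
  set (E := fun s => 0 <= s <= b /\ forall r, 0 <= r < s -> P r).
  destruct (completeness E) as [s [hub hlub]].
  - exists b. intros s [h _]. lra.
  - exists 0. split; [lra|]. intros; lra.
  - assert (hs0 : 0 <= s) by (apply hub; split; [lra|intros; lra]).
    assert (hsb : s <= t0).
    { apply hlub. intros r [hr1 hr2]. apply Rnot_lt_le. intros hc. apply hP, hr2. lra. }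
    assert (hpre : forall r, 0 <= r < s -> P r).
    { intros r hr. apply NNPP. intros hn. enough (s <= r) by lra.
      apply hlub. intros q [hq1 hq2]. apply Rnot_lt_le. intros hc. apply hn, hq2. lra. }
    destruct (hstep s) as [eps [he h]]; [lra|easy|].
    destruct (Rle_lt_dec (s + eps / 2) b) as [hle|hgt].
    + enough (s + eps / 2 <= s) by lra. apply hub. split; [lra|].
      intros r hr. destruct (Rlt_le_dec r s); [apply hpre; lra|apply h; lra].
    + apply hP. apply h. lra.
Qed.

(** * Bounds on compact sets *)

Lemma continuous_on_rectangle_bounded (A B : R -> Prop) (f : R -> R -> R) (a b a' b' : R) :
  (forall x, a <= x <= b -> A x) -> (forall y, a' <= y <= b' -> B y) ->
  continuous_on (fun q : R * R => A (fst q) /\ B (snd q))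
                (fun q : R * R => f (fst q) (snd q)) ->
  exists M, 0 <= M /\ forall x y, a <= x <= b -> a' <= y <= b' -> Rabs (f x y) <= M.
Proof.
  intros hA hB hf.
  set (dom := fun q : R * R => (a <= fst q <= b) /\ (a' <= snd q <= b')).
  assert (hloc : forall q : R * R, exists d : posreal, dom q ->
    forall x y, a <= x <= b -> a' <= y <= b' ->
      Rabs (x - fst q) < d -> Rabs (y - snd q) < d ->
      Rabs (f x y - f (fst q) (snd q)) < 1).
  { intros [u v]; unfold dom; simpl.
    destruct (classic ((a <= u <= b) /\ (a' <= v <= b'))) as [[hu hv]|hn].
    - destruct (proj1 (filterlim_locally _ _)
        (hf (u, v) (conj (hA u hu) (hB v hv))) (mkposreal 1 Rlt_0_1)) as [d hd].
      exists d. intros _ x y hx hy dx dy. apply (hd (x, y)).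
      + split; assumption.
      + split; [now apply hA|now apply hB].
    - exists (mkposreal 1 Rlt_0_1). tauto. }
  set (delta := fun q : Compactness.Tn 2 R =>
    proj1_sig (constructive_indefinite_description _ (hloc (fst q, fst (snd q))))).
  apply NNPP. intros hn.
  apply (compactness_list 2 (a, (a', tt)) (b, (b', tt)) delta). intros [l hl]. apply hn.
  set (bd := fold_right (fun q : Compactness.Tn 2 R => Rmax (Rabs (f (fst q) (fst (snd q))))) 0 l).
  assert (hbd : forall q, In q l -> Rabs (f (fst q) (fst (snd q))) <= bd).
  { unfold bd. clear. induction l as [|r l IH]; [easy|]. intros q [->|hq]; simpl.
    - apply Rmax_l.
    - eapply Rle_trans; [now apply IH|apply Rmax_r]. }
  assert (hbd0 : 0 <= bd).
  { unfold bd. clear. induction l as [|r l IH]; simpl; [lra|].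
    eapply Rle_trans; [exact IH|apply Rmax_r]. }
  exists (1 + bd). split; [lra|]. intros x y hx hy.
  destruct (hl (x, (y, tt))) as [q [hin [hbq hcl]]]; [simpl; tauto|].
  destruct q as [u [v []]]. simpl in hbq, hcl.
  assert (hd : Rabs (f x y - f u v) < 1).
  { destruct hbq as [h1 [h2 _]]. destruct hcl as [h3 [h4 _]].
    exact (proj2_sig (constructive_indefinite_description _ (hloc (u, v)))
             (conj h1 h2) x y hx hy h3 h4). }
  specialize (hbd _ hin). simpl in hbd.
  replace (f x y) with ((f x y - f u v) + f u v) by ring.
  eapply Rle_trans; [apply Rabs_triang|]. lra.
Qed.


(** * Ordinary differential equations with a Lipschitz field *)

(** The distance is the supremum over the index type, written pointwise so that
    no norm is needed and the index type may be infinite. *)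
Definition sup_lipschitz {X : Type} (L : R) (F : (X -> R) -> X -> R) : Prop :=
  forall a b d, (forall i, Rabs (a i - b i) <= d) ->
    forall i, Rabs (F a i - F b i) <= L * d.

Lemma is_derive_exp_scal (C L t : R) :
  0 < L -> is_derive (fun s => C / (2 * L) * exp (2 * L * s)) t (C * exp (2 * L * t)).
Proof. intros hL. auto_derive; [easy|]. field; lra. Qed.

Lemma exponential_growth (D : R -> Prop) (f f' : R -> R) (C L b : R) :
  0 < L -> 0 <= C -> 0 <= b -> (forall t, 0 <= t <= b -> D t) ->
  (forall t, 0 <= t <= b ->
     has_deriv_on D f t (f' t) /\ Rabs (f' t) <= C * exp (2 * L * t)) ->
  Rabs (f b - f 0) <= C / (2 * L) * exp (2 * L * b).
Proof.
  intros hL hC hb hD hf.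
  set (g := fun s => C / (2 * L) * exp (2 * L * s)).
  assert (hg : forall t, has_deriv_on D g t (C * exp (2 * L * t))).
  { intros t. apply is_derive_has_deriv_on. now apply is_derive_exp_scal. }
  assert (hg0 : 0 <= g 0).
  { unfold g. rewrite Rmult_0_r, exp_0. apply Rmult_le_pos; [|lra].
    apply Rdiv_le_0_compat; lra. }
  assert (h0 : forall t, has_deriv_on D (fun _ => 0) t 0).
  { intros t. apply is_derive_has_deriv_on, is_derive_Rconst. }
  apply Rabs_le. change (- g b <= f b - f 0 <= g b). split.
  - enough ((0 - f b) - g b <= (0 - f 0) - g 0) by lra.
    apply (nonincreasing_of_has_deriv_on D (fun s => (0 - f s) - g s)
             (fun t => (0 - f' t) - C * exp (2 * L * t)) b hb hD).
    intros t ht. destruct (hf t ht) as [h1 h2]. apply Rabs_le_between in h2. split; [|lra].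
    now repeat apply has_deriv_on_minus.
  - enough (f b - g b <= f 0 - g 0) by lra.
    apply (nonincreasing_of_has_deriv_on D (fun s => f s - g s)
             (fun t => f' t - C * exp (2 * L * t)) b hb hD).
    intros t ht. destruct (hf t ht) as [h1 h2]. apply Rabs_le_between in h2. split; [|lra].
    now apply has_deriv_on_minus.
Qed.

Lemma Rabs_le_geometric_0 (x C : R) : (forall n, Rabs x <= C * (/ 2) ^ n) -> x = 0.
Proof.
  intros h. assert (hC : 0 <= C).
  { pose proof (h 0%nat) as h0. pose proof (Rabs_pos x). simpl in h0. lra. }
  destruct (Req_dec x 0) as [|hne]; [easy|exfalso].
  assert (hx : 0 < Rabs x) by now apply Rabs_pos_lt.
  assert (hq : 0 < Rabs x / (C + 1)) by (apply Rdiv_lt_0_compat; lra).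
  destruct (pow_lt_1_zero (/ 2)) with (y := Rabs x / (C + 1)) as [N hN]; [|easy|].
  { rewrite Rabs_pos_eq; lra. }
  specialize (hN N (le_n _)). specialize (h N).
  assert (hp : 0 < (/ 2) ^ N) by (apply pow_lt; lra).
  rewrite (Rabs_pos_eq ((/ 2) ^ N)) in hN by lra.
  assert ((C + 1) * (/ 2) ^ N < Rabs x); [|lra].
  replace (Rabs x) with ((C + 1) * (Rabs x / (C + 1))) by (field; lra).
  apply Rmult_lt_compat_l; lra.
Qed.

(** Gronwall by iteration: in the weight [exp (2 L t)] integrating the
    Lipschitz estimate halves the difference. *)
Lemma ode_unique (X : Type) (F : (X -> R) -> X -> R) (D : R -> Prop)
    (L b K : R) (Y Z : R -> X -> R) :
  0 < L -> sup_lipschitz L F -> 0 <= b -> (forall t, 0 <= t <= b -> D t) ->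
  (forall t i, 0 <= t <= b -> has_deriv_on D (fun s => Y s i) t (F (Y t) i)) ->
  (forall t i, 0 <= t <= b -> has_deriv_on D (fun s => Z s i) t (F (Z t) i)) ->
  (forall i, Y 0 i = Z 0 i) ->
  (forall t i, 0 <= t <= b -> Rabs (Y t i - Z t i) <= K) ->
  forall t i, 0 <= t <= b -> Y t i = Z t i.
Proof.
  intros hL hF hb hD hY hZ h0 hK t i ht.
  assert (hit : forall n t i, 0 <= t <= b ->
    Rabs (Y t i - Z t i) <= K * (/ 2) ^ n * exp (2 * L * t)).
  { assert (hK0 : 0 <= K) by (eapply Rle_trans; [apply Rabs_pos|apply (hK 0 i); lra]).
    induction n as [|n IH]; intros r k hr.
    - simpl. eapply Rle_trans; [now apply hK|]. rewrite Rmult_1_r.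
      assert (1 <= exp (2 * L * r)).
      { pose proof (exp_ineq1_le (2 * L * r)). assert (0 <= 2 * L * r); [|lra].
        apply Rmult_le_pos; lra. }
      nra.
    - assert (hh : Rabs ((Y r k - Z r k) - (Y 0 k - Z 0 k)) <=
        (L * (K * (/ 2) ^ n)) / (2 * L) * exp (2 * L * r)).
      { apply (exponential_growth D (fun s => Y s k - Z s k)
                 (fun s => F (Y s) k - F (Z s) k)); try easy.
        - assert (0 < (/ 2) ^ n) by (apply pow_lt; lra).
          repeat apply Rmult_le_pos; lra.
        - intros s hs. apply hD; lra.
        - intros s hs. split.
          + apply has_deriv_on_minus; [apply hY|apply hZ]; lra.
          + rewrite Rmult_assoc. apply hF. intros j. apply IH; lra. }
      rewrite h0 in hh. replace (Y r k - Z r k - (Z 0 k - Z 0 k)) with (Y r k - Z r k) in hh by ring.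
      eapply Rle_trans; [exact hh|]. right. simpl. field. lra. }
  apply Rminus_diag_uniq. apply (Rabs_le_geometric_0 _ (K * exp (2 * L * t))).
  intros n. eapply Rle_trans; [now apply (hit n)|]. right; ring.
Qed.

Lemma geometric_limit (a : nat -> R) (C : R) :
  (forall n, Rabs (a (S n) - a n) <= C * (/ 2) ^ n) ->
  {l | forall n, Rabs (a n - l) <= 2 * C * (/ 2) ^ n}.
Proof.
  intros h.
  assert (hC : 0 <= C).
  { pose proof (h 0%nat) as h0. simpl in h0. pose proof (Rabs_pos (a 1%nat - a 0%nat)). lra. }
  assert (hp : forall n, 0 < (/ 2) ^ n) by (intros; apply pow_lt; lra).
  (* The intervals of centre [a n] and radius [2 C 2^-n] are nested. *)
  assert (hlo : forall n k, a n - 2 * C * (/ 2) ^ n <= a (n + k)%nat - 2 * C * (/ 2) ^ (n + k)).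
  { intros n k. induction k as [|k IH]; [rewrite Nat.add_0_r; lra|].
    rewrite Nat.add_succ_r. specialize (h (n + k)%nat). apply Rabs_le_between in h.
    simpl. lra. }
  assert (hhi : forall n k, a (n + k)%nat + 2 * C * (/ 2) ^ (n + k) <= a n + 2 * C * (/ 2) ^ n).
  { intros n k. induction k as [|k IH]; [rewrite Nat.add_0_r; lra|].
    rewrite Nat.add_succ_r. specialize (h (n + k)%nat). apply Rabs_le_between in h.
    simpl. lra. }
  assert (hlh : forall n m, a n - 2 * C * (/ 2) ^ n <= a m + 2 * C * (/ 2) ^ m).
  { intros n m. specialize (hlo n m). specialize (hhi m n).
    rewrite (Nat.add_comm m n) in hhi. specialize (hp (n + m)%nat). nra. }
  destruct (completeness (fun y => exists n, y = a n - 2 * C * (/ 2) ^ n)) as [l [hub hlub]].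
  - exists (a 0%nat + 2 * C * (/ 2) ^ 0). intros y [n ->]. apply hlh.
  - now exists (a 0%nat - 2 * C * (/ 2) ^ 0), 0%nat.
  - exists l. intros n. apply Rabs_le. split.
    + enough (l <= a n + 2 * C * (/ 2) ^ n) by lra. apply hlub. intros y [m ->]. apply hlh.
    + enough (a n - 2 * C * (/ 2) ^ n <= l) by lra. apply hub. now exists n.
Qed.

Lemma lipschitz_continuous (f : R -> R) (C : R) :
  0 <= C -> (forall s t, Rabs (f s - f t) <= C * Rabs (s - t)) -> forall t, continuous f t.
Proof.
  intros hC h t. apply continuous_eps. intros eps he.
  exists (eps / (C + 1)). split; [apply Rdiv_lt_0_compat; lra|]. intros s hs.
  eapply Rle_lt_trans; [apply h|].
  apply Rle_lt_trans with ((C + 1) * Rabs (s - t)).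
  - pose proof (Rabs_pos (s - t)). lra.
  - replace eps with ((C + 1) * (eps / (C + 1))) by (field; lra).
    apply Rmult_lt_compat_l; lra.
Qed.

Lemma is_derive_RInt_continuous (f : R -> R) (y t : R) :
  (forall s, continuous f s) -> is_derive (fun s => y + RInt f 0 s) t (f t).
Proof.
  intros hf. apply (is_derive_eq _ _ (0 + f t)); [|ring].
  apply is_derive_Rplus; [apply is_derive_Rconst|].
  apply (is_derive_RInt f (fun s => RInt f 0 s) 0 t); [|apply hf].
  apply filter_forall. intros s. apply (RInt_correct f 0 s), (ex_RInt_continuous f 0 s).
  intros; apply hf.
Qed.

(** The field is frozen at its initial value for negative times, which makes
    every iterate differentiable on the whole line. *)
Fixpoint picard_iterate {X : Type} (F : (X -> R) -> X -> R) (y0 : X -> R) (n : nat)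
    : R -> X -> R :=
  match n with
  | O => fun _ i => y0 i
  | S n => fun t i => y0 i + RInt (fun s => F (picard_iterate F y0 n (Rmax 0 s)) i) 0 t
  end.

Lemma Rmax_0_lipschitz (s t : R) : Rabs (Rmax 0 s - Rmax 0 t) <= Rabs (s - t).
Proof. unfold Rmax, Rabs; repeat destruct Rle_dec; repeat destruct Rcase_abs; lra. Qed.

Lemma RInt_bounded_lipschitz (f : R -> R) (B y : R) :
  (forall s, continuous f s) -> (forall s, Rabs (f s) <= B) ->
  forall s t, Rabs ((y + RInt f 0 s) - (y + RInt f 0 t)) <= B * Rabs (s - t).
Proof.
  intros hc hB s t.
  assert (he : forall a b, ex_RInt f a b) by (intros a b; apply (ex_RInt_continuous f a b); intros; apply hc).
  assert (haux : forall a b, a <= b -> Rabs ((y + RInt f 0 b) - (y + RInt f 0 a)) <= B * (b - a)).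
  { intros a b hab.
    assert (hch : RInt f 0 a + RInt f a b = RInt f 0 b) by (apply (RInt_Chasles f); apply he).
    replace (y + RInt f 0 b - (y + RInt f 0 a)) with (RInt f a b) by lra.
    rewrite Rmult_comm. apply abs_RInt_le_const; auto. }
  destruct (Rle_dec t s).
  - rewrite (Rabs_pos_eq (s - t)) by lra. now apply haux.
  - rewrite Rabs_minus_sym, (Rabs_minus_sym s t), (Rabs_pos_eq (t - s)) by lra. apply haux; lra.
Qed.

Lemma field_along_lipschitz_continuous (X : Type) (F : (X -> R) -> X -> R) (L B : R)
    (Y : R -> X -> R) (i : X) :
  0 <= L -> 0 <= B -> sup_lipschitz L F ->
  (forall s t k, 0 <= s -> 0 <= t -> Rabs (Y s k - Y t k) <= B * Rabs (s - t)) ->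
  forall t, continuous (fun s => F (Y (Rmax 0 s)) i) t.
Proof.
  intros hL hB hF hY. apply (lipschitz_continuous _ (L * B)); [now apply Rmult_le_pos|].
  intros s t. rewrite Rmult_assoc. apply hF. intros k.
  eapply Rle_trans; [apply hY; apply Rmax_l|].
  apply Rmult_le_compat_l; [easy|apply Rmax_0_lipschitz].
Qed.

(** Successive approximations converge geometrically in the weight
    [exp (2 L t)], hence on the whole half-line at once. *)
Theorem picard (X : Type) (F : (X -> R) -> X -> R) (L B : R) (y0 : X -> R) :
  0 < L -> 0 <= B -> sup_lipschitz L F -> (forall a i, Rabs (F a i) <= B) ->
  exists Y : R -> X -> R, (forall i, Y 0 i = y0 i) /\
    forall t i, 0 <= t -> is_derive (fun s => Y s i) t (F (Y t) i).
Proof.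
  intros hL hB hF hFB.
  set (P := picard_iterate F y0).
  assert (hlip : forall n s t k, Rabs (P n s k - P n t k) <= B * Rabs (s - t)).
  { induction n as [|n IH]; intros s t k; simpl.
    - rewrite Rminus_diag, Rabs_R0. apply Rmult_le_pos; [easy|apply Rabs_pos].
    - apply RInt_bounded_lipschitz; [|intros; apply hFB].
      apply (field_along_lipschitz_continuous X F L B); auto; lra. }
  assert (hcont : forall n k t, continuous (fun s => F (P n (Rmax 0 s)) k) t).
  { intros n k. apply (field_along_lipschitz_continuous X F L B); auto; lra. }
  assert (hder : forall n k t, is_derive (fun s => P (S n) s k) t (F (P n (Rmax 0 t)) k)).
  { intros n k t. apply (is_derive_RInt_continuous (fun s => F (P n (Rmax 0 s)) k)).
    apply hcont. }
  assert (hP0 : forall n k, P n 0 k = y0 k).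
  { intros [|n] k; [easy|]. unfold P; simpl. rewrite (RInt_point 0). apply Rplus_0_r. }
  set (A := B / (2 * L)).
  assert (hA : 0 <= A) by (apply Rdiv_le_0_compat; lra).
  assert (hstep : forall n t k, 0 <= t ->
    Rabs (P (S n) t k - P n t k) <= A * exp (2 * L * t) * (/ 2) ^ n).
  { induction n as [|n IH]; intros t k ht.
    - replace (P 0%nat t k) with (P 1%nat 0 k) by apply hP0.
      eapply Rle_trans; [apply hlip|]. rewrite Rminus_0_r, Rabs_pos_eq by easy.
      simpl. rewrite Rmult_1_r. pose proof (exp_ineq1_le (2 * L * t)) as he.
      replace (B * t) with (A * (2 * L * t)) by (unfold A; field; lra).
      apply Rmult_le_compat_l; lra.
    - assert (hg : Rabs ((P (S (S n)) t k - P (S n) t k) - (P (S (S n)) 0 k - P (S n) 0 k)) <=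
        (L * (A * (/ 2) ^ n)) / (2 * L) * exp (2 * L * t)).
      { apply (exponential_growth (fun _ => True) (fun s => P (S (S n)) s k - P (S n) s k)
          (fun s => F (P (S n) (Rmax 0 s)) k - F (P n (Rmax 0 s)) k)); try easy.
        - assert (0 < (/ 2) ^ n) by (apply pow_lt; lra). apply Rmult_le_pos; [lra|]; apply Rmult_le_pos; lra.
        - intros s hs. split.
          + apply has_deriv_on_minus; apply is_derive_has_deriv_on; apply hder.
          + rewrite Rmult_assoc. apply hF. intros j. rewrite Rmax_right by lra.
            eapply Rle_trans; [apply IH; lra|]. right; ring. }
      rewrite !hP0 in hg. rewrite Rminus_diag, Rminus_0_r in hg.
      eapply Rle_trans; [exact hg|]. right; simpl; field; lra. }
  set (Q := fun t k => proj1_sig (geometric_limit (fun n => P n (Rmax 0 t) k) _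
              (fun n => hstep n (Rmax 0 t) k (Rmax_l 0 t)))).
  assert (hQ : forall t k n, 0 <= t ->
    Rabs (P n t k - Q t k) <= 2 * (A * exp (2 * L * t)) * (/ 2) ^ n).
  { intros t k n ht. unfold Q. destruct geometric_limit as [l hl]; simpl.
    rewrite Rmax_right in hl by easy. apply hl. }
  assert (hQlip : forall s t k, 0 <= s -> 0 <= t -> Rabs (Q s k - Q t k) <= B * Rabs (s - t)).
  { intros s t k hs ht. apply Rnot_lt_le. intros hc.
    set (e := Rabs (Q s k - Q t k) - B * Rabs (s - t)) in *.
    enough (e = 0) by (unfold e in *; lra).
    apply (Rabs_le_geometric_0 _ (2 * (A * exp (2 * L * s)) + 2 * (A * exp (2 * L * t)))).
    intros n. rewrite Rabs_pos_eq by (unfold e; lra).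
    specialize (hlip n s t k). pose proof (hQ s k n hs). pose proof (hQ t k n ht).
    assert (Rabs (Q s k - Q t k) <= Rabs (P n s k - Q s k) + Rabs (P n t k - Q t k)
              + Rabs (P n s k - P n t k)); [|unfold e; lra].
    unfold Rabs; repeat destruct Rcase_abs; lra. }
  assert (hQcont : forall k t, continuous (fun s => F (Q (Rmax 0 s)) k) t).
  { intros k. apply (field_along_lipschitz_continuous X F L B); auto; lra. }
  set (Y := fun t k => y0 k + RInt (fun s => F (Q (Rmax 0 s)) k) 0 t).
  assert (hder' : forall t k, is_derive (fun s => Y s k) t (F (Q (Rmax 0 t)) k)).
  { intros t k. apply (is_derive_RInt_continuous (fun s => F (Q (Rmax 0 s)) k)).
    apply hQcont. }
  assert (hY0 : forall k, Y 0 k = y0 k).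
  { intros k. unfold Y. rewrite (RInt_point 0). apply Rplus_0_r. }
  assert (hYQ : forall t k, 0 <= t -> Y t k = Q t k).
  { intros t k ht. apply Rminus_diag_uniq.
    apply (Rabs_le_geometric_0 _ (2 * (A * exp (2 * L * t)))).
    intros n.
    assert (hg : Rabs ((P (S n) t k - Y t k) - (P (S n) 0 k - Y 0 k)) <=
        (L * (2 * A * (/ 2) ^ n)) / (2 * L) * exp (2 * L * t)).
    { apply (exponential_growth (fun _ => True) (fun s => P (S n) s k - Y s k)
          (fun s => F (P n (Rmax 0 s)) k - F (Q (Rmax 0 s)) k)); try easy.
      - assert (0 < (/ 2) ^ n) by (apply pow_lt; lra). apply Rmult_le_pos; [lra|]; apply Rmult_le_pos; lra.
      - intros s hs. split.
        + apply has_deriv_on_minus; apply is_derive_has_deriv_on; [apply hder|apply hder'].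
        + rewrite Rmult_assoc. apply hF. intros j. rewrite Rmax_right by lra.
          eapply Rle_trans; [apply hQ; lra|]. right; ring. }
    rewrite hP0, hY0, Rminus_diag, Rminus_0_r in hg.
    pose proof (hQ t k (S n) ht) as hq.
    assert (hgoal : Rabs (Y t k - Q t k) <= Rabs (P (S n) t k - Y t k) + Rabs (P (S n) t k - Q t k)).
    { unfold Rabs; repeat destruct Rcase_abs; lra. }
    eapply Rle_trans; [exact hgoal|]. eapply Rle_trans; [apply Rplus_le_compat; [exact hg|exact hq]|].
    right. simpl. field. lra. }
  exists Y. split; [exact hY0|]. intros t k ht.
  apply (is_derive_eq _ _ _ _ (hder' t k)). rewrite Rmax_right by easy.
  apply Rminus_diag_uniq, (Rabs_le_geometric_0 _ 0). intros n.
  rewrite Rmult_0_l. replace 0 with (L * 0) by ring. apply hF. intros j.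
  rewrite hYQ by easy. rewrite Rminus_diag, Rabs_R0. lra.
Qed.


(** * Sums over a period *)

(** Unlike [sumJ], this also covers the empty sum, as partial sums of the
    momentum require. *)
Fixpoint sumn (n : nat) (a : Z -> R) : R :=
  match n with
  | O => 0
  | S n => sumn n a + a (Z.of_nat n)
  end.

Lemma sumJ_sumn (J : nat) (a : Z -> R) : (1 <= J)%nat -> sumJ J a = sumn J a.
Proof.
  unfold sumJ. destruct J as [|n]; [lia|]. intros _. simpl. rewrite Nat.sub_0_r.
  induction n as [|n IH]; simpl; [ring|]. simpl in IH. now rewrite IH.
Qed.

Lemma sumn_ext (n : nat) (a b : Z -> R) :
  (forall j, (0 <= j < Z.of_nat n)%Z -> a j = b j) -> sumn n a = sumn n b.
Proof.
  induction n as [|n IH]; intros h; cbn [sumn]; [easy|].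
  rewrite IH, (h (Z.of_nat n)); [easy|lia|]. intros j hj. apply h. lia.
Qed.

Lemma sumn_plus (n : nat) (a b : Z -> R) :
  sumn n (fun j => a j + b j) = sumn n a + sumn n b.
Proof. induction n as [|n IH]; cbn [sumn]; [ring|]. rewrite IH; ring. Qed.

Lemma sumn_minus (n : nat) (a b : Z -> R) :
  sumn n (fun j => a j - b j) = sumn n a - sumn n b.
Proof. induction n as [|n IH]; cbn [sumn]; [ring|]. rewrite IH; ring. Qed.

Lemma sumn_scal (n : nat) (k : R) (a : Z -> R) :
  sumn n (fun j => k * a j) = k * sumn n a.
Proof. induction n as [|n IH]; cbn [sumn]; [ring|]. rewrite IH; ring. Qed.

Lemma sumn_le (n : nat) (a b : Z -> R) :
  (forall j, (0 <= j < Z.of_nat n)%Z -> a j <= b j) -> sumn n a <= sumn n b.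
Proof.
  induction n as [|n IH]; intros h; cbn [sumn]; [lra|].
  apply Rplus_le_compat; [apply IH; intros j hj; apply h; lia|apply h; lia].
Qed.

Lemma sumn_nonneg (n : nat) (a : Z -> R) :
  (forall j, (0 <= j < Z.of_nat n)%Z -> 0 <= a j) -> 0 <= sumn n a.
Proof.
  induction n as [|n IH]; intros h; cbn [sumn]; [lra|].
  apply Rplus_le_le_0_compat; [apply IH; intros j hj; apply h; lia|apply h; lia].
Qed.

Lemma sumn_Rabs (n : nat) (a : Z -> R) : Rabs (sumn n a) <= sumn n (fun j => Rabs (a j)).
Proof.
  induction n as [|n IH]; cbn [sumn]; [rewrite Rabs_R0; lra|].
  eapply Rle_trans; [apply Rabs_triang|lra].
Qed.

Lemma sumn_mono (n m : nat) (a : Z -> R) :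
  (n <= m)%nat -> (forall j, (0 <= j < Z.of_nat m)%Z -> 0 <= a j) -> sumn n a <= sumn m a.
Proof.
  intros hnm h. induction m as [|m IH]; [now replace n with 0%nat by lia; right|].
  destruct (Nat.eq_dec n (S m)) as [->|]; [lra|]. cbn [sumn].
  assert (sumn n a <= sumn m a) by (apply IH; [lia|intros j hj; apply h; lia]).
  assert (0 <= a (Z.of_nat m)) by (apply h; lia). lra.
Qed.

Lemma sumn_term_le (n : nat) (a : Z -> R) (k : Z) :
  (forall j, (0 <= j < Z.of_nat n)%Z -> 0 <= a j) -> (0 <= k < Z.of_nat n)%Z ->
  a k <= sumn n a.
Proof.
  intros h hk. eapply Rle_trans; [|apply (sumn_mono (S (Z.to_nat k)) n a); [lia|easy]].
  cbn [sumn]. rewrite Z2Nat.id by lia.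
  enough (0 <= sumn (Z.to_nat k) a) by lra.
  apply sumn_nonneg. intros j hj. apply h. lia.
Qed.

Lemma sumn_shift (n : nat) (a : Z -> R) :
  sumn n (fun j => a (j + 1)%Z) = sumn n a + a (Z.of_nat n) - a 0%Z.
Proof.
  induction n as [|n IH]; cbn [sumn]; [simpl; ring|]. rewrite IH.
  replace (Z.of_nat n + 1)%Z with (Z.of_nat (S n)) by lia. ring.
Qed.

Lemma sumn_telescope (n : nat) (a : Z -> R) :
  sumn n (fun j => a (j + 1)%Z - a j) = a (Z.of_nat n) - a 0%Z.
Proof. rewrite sumn_minus, sumn_shift. ring. Qed.

Lemma sumn_periodic_shift (J : nat) (a : Z -> R) :
  periodic J a -> sumn J (fun j => a (j + 1)%Z) = sumn J a.
Proof. intros h. rewrite sumn_shift. rewrite <- (h 0%Z). simpl. ring. Qed.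

Lemma summation_by_parts (J : nat) (u s : Z -> R) :
  periodic J u -> periodic J s ->
  sumn J (fun j => u j * (s (j + 1)%Z - s j)) = - sumn J (fun j => (u j - u (j - 1)%Z) * s j).
Proof.
  intros hu hs.
  assert (hp : periodic J (fun j => u (j - 1)%Z * s j)).
  { intros j. replace (j + Z.of_nat J - 1)%Z with ((j - 1) + Z.of_nat J)%Z by lia.
    now rewrite hu, hs. }
  rewrite (sumn_ext J _ (fun j => u (j + 1 - 1)%Z * s (j + 1)%Z - u j * s j)).
  - rewrite sumn_minus, (sumn_periodic_shift J _ hp).
    rewrite (sumn_ext J (fun j => (u j - u (j - 1)%Z) * s j)
      (fun j => u j * s j - u (j - 1)%Z * s j)) by (intros; ring).
    rewrite sumn_minus. ring.
  - intros j _. replace (j + 1 - 1)%Z with j by lia. ring.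
Qed.

Lemma is_derive_sumn (n : nat) (f : R -> Z -> R) (f' : Z -> R) (t : R) :
  (forall j, (0 <= j < Z.of_nat n)%Z -> is_derive (fun s => f s j) t (f' j)) ->
  is_derive (fun s => sumn n (f s)) t (sumn n f').
Proof.
  induction n as [|n IH]; intros h; cbn [sumn]; [apply is_derive_Rconst|].
  apply is_derive_Rplus; [apply IH; intros j hj; apply h; lia|apply h; lia].
Qed.

Lemma continuous_sumn (n : nat) (f : R -> Z -> R) (t : R) :
  (forall j, (0 <= j < Z.of_nat n)%Z -> continuous (fun s => f s j) t) ->
  continuous (fun s => sumn n (f s)) t.
Proof.
  induction n as [|n IH]; intros h; cbn [sumn]; [apply continuous_const|].
  apply (continuous_plus (V := R_NormedModule) (fun s => sumn n (f s))
           (fun s => f s (Z.of_nat n)));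
    [apply IH; intros j hj; apply h; lia|apply h; lia].
Qed.

(** * Periodic sequences *)

Lemma periodic_mult (J : nat) (a : Z -> R) (n : Z) :
  periodic J a -> forall j, a (j + n * Z.of_nat J)%Z = a j.
Proof.
  intros h.
  assert (hpos : forall (k : nat) j, a (j + Z.of_nat k * Z.of_nat J)%Z = a j).
  { induction k as [|k IH]; intros j; [f_equal; lia|].
    replace (j + Z.of_nat (S k) * Z.of_nat J)%Z with
      ((j + Z.of_nat k * Z.of_nat J) + Z.of_nat J)%Z by lia. now rewrite h. }
  intros j. destruct (Z_le_gt_dec 0 n).
  - rewrite <- (hpos (Z.to_nat n) j). now rewrite Z2Nat.id.
  - rewrite <- (hpos (Z.to_nat (- n)) (j + n * Z.of_nat J)%Z). rewrite Z2Nat.id by lia.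
    f_equal. lia.
Qed.

Lemma periodic_reduce (J : nat) (j : Z) : (1 <= J)%nat ->
  exists k, (0 <= k < Z.of_nat J)%Z /\ forall a, periodic J a -> a j = a k.
Proof.
  intros hJ. exists (j mod Z.of_nat J)%Z. split; [apply Z.mod_pos_bound; lia|].
  intros a ha. rewrite <- (periodic_mult J a (j / Z.of_nat J) ha (j mod Z.of_nat J)%Z).
  f_equal. rewrite (Z.div_mod j (Z.of_nat J)) at 1 by lia. ring.
Qed.

Lemma periodic_forall (J : nat) (a : Z -> R) (P : R -> Prop) : (1 <= J)%nat ->
  periodic J a -> (forall j, (0 <= j < Z.of_nat J)%Z -> P (a j)) -> forall j, P (a j).
Proof.
  intros hJ ha h j. destruct (periodic_reduce J j hJ) as [k [hk e]].
  rewrite (e a ha). now apply h.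
Qed.

Lemma dx_periodic (J : nat) (x : Z -> R) : periodic_lift J x -> periodic J (dx x).
Proof.
  intros h j. unfold dx. rewrite h.
  replace (j + Z.of_nat J - 1)%Z with (j - 1 + Z.of_nat J)%Z by lia. rewrite h. ring.
Qed.

Lemma dx_pos (J : nat) (x : Z -> R) : (1 <= J)%nat ->
  periodic_lift J x -> ordered J x -> forall j, 0 < dx x j.
Proof.
  intros hJ h ho. apply (periodic_forall J (dx x)); auto using dx_periodic.
  intros j hj. specialize (ho j hj). unfold dx. lra.
Qed.

Lemma sumn_dx (J : nat) (x : Z -> R) : periodic_lift J x -> sumn J (dx x) = 1.
Proof.
  intros h. pose proof (sumn_telescope J (fun j => x (j - 1)%Z)) as ht. simpl in ht.
  rewrite (sumn_ext J _ (fun j => x (j + 1 - 1)%Z - x (j - 1)%Z)).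
  - rewrite ht. specialize (h (-1)%Z).
    replace (-1 + Z.of_nat J)%Z with (Z.of_nat J - 1)%Z in h by lia. rewrite h. ring.
  - intros j _. unfold dx. now replace (j + 1 - 1)%Z with j by lia.
Qed.

Lemma minJ_le (J : nat) (a : Z -> R) : (1 <= J)%nat -> periodic J a -> forall j, minJ J a <= a j.
Proof.
  intros hJ ha. apply (periodic_forall J a (fun r => minJ J a <= r)); auto. intros j hj. apply MinRlist_P1.
  apply in_map_iff. exists (Z.to_nat j). split; [f_equal; lia|]. apply in_seq. lia.
Qed.

Lemma maxJ_ge (J : nat) (a : Z -> R) : (1 <= J)%nat -> periodic J a -> forall j, a j <= maxJ J a.
Proof.
  intros hJ ha. apply (periodic_forall J a (fun r => r <= maxJ J a)); auto. intros j hj. apply MaxRlist_P1.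
  apply in_map_iff. exists (Z.to_nat j). split; [f_equal; lia|]. apply in_seq. lia.
Qed.

Lemma MinRlist_In (l : list R) : l <> nil -> In (MinRlist l) l.
Proof.
  induction l as [|a [|b l] IH]; intros h; [easy|now left|].
  change (In (Rmin a (MinRlist (b :: l))) (a :: b :: l)).
  unfold Rmin; destruct Rle_dec; [now left|right; now apply IH].
Qed.

Lemma minJ_attained (J : nat) (a : Z -> R) : (1 <= J)%nat -> exists j, minJ J a = a j.
Proof.
  intros hJ. assert (h : In (minJ J a) (map (fun k => a (Z.of_nat k)) (seq 0 J))).
  { apply MinRlist_In. destruct J; [lia|easy]. }
  apply in_map_iff in h. destruct h as [k [e _]]. now exists (Z.of_nat k).
Qed.

Lemma maxJ_attained (J : nat) (a : Z -> R) : (1 <= J)%nat -> exists j, maxJ J a = a j.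
Proof.
  intros hJ. assert (h : In (maxJ J a) (map (fun k => a (Z.of_nat k)) (seq 0 J))).
  { apply MaxRlist_P2. exists (a (Z.of_nat 0)). destruct J; [lia|now left]. }
  apply in_map_iff in h. destruct h as [k [e _]]. now exists (Z.of_nat k).
Qed.

Lemma periodic_lower_bound (J : nat) (a : Z -> R) : (1 <= J)%nat -> periodic J a ->
  (forall j, 0 < a j) -> exists r, 0 < r /\ forall j, r <= a j.
Proof.
  intros hJ ha hp. destruct (minJ_attained J a hJ) as [k e]. exists (minJ J a).
  split; [now rewrite e|]. now apply minJ_le.
Qed.

Lemma periodic_upper_bound (J : nat) (a : Z -> R) : (1 <= J)%nat -> periodic J a ->
  exists r, 0 <= r /\ forall j, Rabs (a j) <= r.
Proof.
  intros hJ ha. exists (maxJ J (fun j => Rabs (a j))).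
  assert (hp : periodic J (fun j => Rabs (a j))) by (intros j; now rewrite ha).
  assert (h := maxJ_ge J _ hJ hp). split; [|exact h].
  eapply Rle_trans; [apply Rabs_pos|apply (h 0%Z)].
Qed.


(** * The reduced system *)

Definition specific_energy (q : Z -> R -> R) (j : Z) (r : R) : R :=
  RInt (fun s => q j s / s ^ 2) 1 r.

(** The masses [m j] and the concentrations are constant in time.  What remains
    is a second-order system for the interfaces, with a viscosity [nu j] and a
    pressure law [q j] attached to each cell. *)
Record fluid (J : nat) (m nu : Z -> R) (q : Z -> R -> R) (nu_min nu_max C0 P1 : R)
    : Prop := {
  fl_J : (1 <= J)%nat;
  fl_m_periodic : periodic J m;
  fl_nu_periodic : periodic J nu;
  fl_q_periodic : forall r, periodic J (fun j => q j r);
  fl_m_pos : forall j, 0 < m j;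
  fl_nu_min : 0 < nu_min;
  fl_nu : forall j, nu_min <= nu j <= nu_max;
  fl_q_continuous : forall j r, 0 < r -> continuous (q j) r;
  fl_q_nonneg : forall j r, 0 < r -> 0 <= q j r;
  fl_C0 : 0 < C0;
  fl_q_energy : forall j r, 0 < r -> q j r <= C0 * (r + r * specific_energy q j r);
  fl_P1 : 0 <= P1;
  fl_q_small : forall j r, 0 < r <= 1 -> q j r <= P1
}.

Definition mass_h (m : Z -> R) (j : Z) : R := (m j + m (j + 1)%Z) / 2.

Definition stress (m nu : Z -> R) (q : Z -> R -> R) (X V : Z -> R) (j : Z) : R :=
  nu j * Du X V j - q j (m j / dx X j).

Definition accel (m nu : Z -> R) (q : Z -> R -> R) (X V : Z -> R) (j : Z) : R :=
  (stress m nu q X V (j + 1)%Z - stress m nu q X V j) / mass_h m j.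

Record motion (J : nat) (m nu : Z -> R) (q : Z -> R -> R) (b : R) (x u : R -> Z -> R)
    : Prop := {
  mo_x_periodic : forall t, 0 <= t <= b -> periodic_lift J (x t);
  mo_u_periodic : forall t, 0 <= t <= b -> periodic J (u t);
  mo_dx_pos : forall t j, 0 <= t <= b -> 0 < dx (x t) j;
  mo_x : forall t j, 0 <= t <= b -> is_derive (fun s => x s j) t (u t j);
  mo_u : forall t j, 0 <= t <= b ->
    is_derive (fun s => u s j) t (accel m nu q (x t) (u t) j)
}.

Definition kinetic (J : nat) (m : Z -> R) (V : Z -> R) : R :=
  / 2 * sumn J (fun j => mass_h m j * V j ^ 2).

Definition potential (J : nat) (m : Z -> R) (q : Z -> R -> R) (X : Z -> R) : R :=
  sumn J (fun j => m j * specific_energy q j (m j / dx X j)).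

Definition dissipation (J : nat) (nu : Z -> R) (X V : Z -> R) : R :=
  sumn J (fun j => nu j * Du X V j ^ 2 * dx X j).

Definition partial_momentum (m V : Z -> R) (j : Z) : R :=
  sumn (Z.to_nat j) (fun k => mass_h m k * V k).

Definition mean_momentum (J : nat) (m X V : Z -> R) : R :=
  sumn J (fun j => dx X j * partial_momentum m V j).

Lemma is_derive_dx (x u : R -> Z -> R) (t : R) (j : Z) :
  (forall k, is_derive (fun s => x s k) t (u t k)) ->
  is_derive (fun s => dx (x s) j) t (u t j - u t (j - 1)%Z).
Proof. intros h. now apply is_derive_Rminus. Qed.

Lemma is_derive_density (m : R) (w : R -> R) (t w' : R) :
  0 < w t -> is_derive w t w' ->
  is_derive (fun s => m / w s) t (- (m / w t) * (w' / w t)).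
Proof.
  intros hw h. apply (is_derive_Rcomp (fun y => m / y) w t (- m / (w t) ^ 2) w') in h.
  - apply (is_derive_eq _ _ _ _ h). field. lra.
  - auto_derive; [lra|]. field. lra.
Qed.

Lemma is_derive_ln (f : R -> R) (t f' : R) :
  0 < f t -> is_derive f t f' -> is_derive (fun s => ln (f s)) t (f' / f t).
Proof.
  intros hf h. apply (is_derive_Rcomp ln f t (/ f t) f') in h.
  - apply (is_derive_eq _ _ _ _ h). field. lra.
  - apply is_derive_Reals. now apply derivable_pt_lim_ln.
Qed.

Lemma Rabs_le_half_square (y : R) : Rabs y <= / 2 * (1 + y ^ 2).
Proof.
  pose proof (pow2_ge_0 (y + 1)). pose proof (pow2_ge_0 (y - 1)).
  unfold Rabs; destruct Rcase_abs; simpl in *; lra.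
Qed.

Section Fluid.

Context (J : nat) (m nu : Z -> R) (q : Z -> R -> R) (nu_min nu_max C0 P1 : R).
Context (fl : fluid J m nu q nu_min nu_max C0 P1).

Lemma mass_h_pos (j : Z) : 0 < mass_h m j.
Proof.
  unfold mass_h. pose proof (fl_m_pos _ _ _ _ _ _ _ _ fl j).
  pose proof (fl_m_pos _ _ _ _ _ _ _ _ fl (j + 1)%Z). lra.
Qed.

Lemma sumn_mass_h : sumn J (mass_h m) = sumn J m.
Proof.
  unfold mass_h. rewrite (sumn_ext J _ (fun j => / 2 * m j + / 2 * m (j + 1)%Z)) by (intros; field).
  rewrite sumn_plus, !sumn_scal, (sumn_periodic_shift J m); [field|].
  apply fl.
Qed.

Lemma stress_periodic (X V : Z -> R) :
  periodic_lift J X -> periodic J V -> periodic J (stress m nu q X V).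
Proof.
  intros hX hV j. unfold stress, Du. pose proof (dx_periodic J X hX) as hd.
  replace (j + Z.of_nat J - 1)%Z with (j - 1 + Z.of_nat J)%Z by lia.
  rewrite !hV, !hd, (fl_m_periodic _ _ _ _ _ _ _ _ fl), (fl_nu_periodic _ _ _ _ _ _ _ _ fl).
  f_equal. apply (fl_q_periodic _ _ _ _ _ _ _ _ fl).
Qed.

Lemma is_derive_specific_energy (j : Z) (r : R) :
  0 < r -> is_derive (specific_energy q j) r (q j r / r ^ 2).
Proof.
  intros hr.
  assert (hc : forall s, 0 < s -> continuous (fun s => q j s / s ^ 2) s).
  { intros s hs. apply (continuous_mult (K := R_AbsRing) (q j) (fun s => / s ^ 2)).
    - now apply (fl_q_continuous _ _ _ _ _ _ _ _ fl).
    - apply (is_derive_continuous _ _ (- (2 * s) / (s ^ 2) ^ 2)). auto_derive; [nra|]. field. lra. }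
  apply (is_derive_RInt (fun s => q j s / s ^ 2) (specific_energy q j) 1 r); [|now apply hc].
  exists (mkposreal r hr). intros s hs.
  assert (hs0 : 0 < s).
  { change (Rabs (s - r) < r) in hs. apply Rabs_def2 in hs. lra. }
  apply (RInt_correct (fun s => q j s / s ^ 2) 1 s).
  apply (ex_RInt_continuous (fun s => q j s / s ^ 2) 1 s). intros z hz. apply hc.
  apply Rlt_le_trans with (Rmin 1 s); [apply Rmin_pos; lra|easy].
Qed.

(** * Energy *)

Lemma kinetic_nonneg (V : Z -> R) : 0 <= kinetic J m V.
Proof.
  apply Rmult_le_pos; [lra|]. apply sumn_nonneg. intros j _.
  apply Rmult_le_pos; [left; apply mass_h_pos|apply pow2_ge_0].
Qed.

Lemma dissipation_nonneg (X V : Z -> R) : (forall j, 0 < dx X j) -> 0 <= dissipation J nu X V.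
Proof.
  intros hX. apply sumn_nonneg. intros j _.
  pose proof (fl_nu _ _ _ _ _ _ _ _ fl j). pose proof (fl_nu_min _ _ _ _ _ _ _ _ fl).
  apply Rmult_le_pos; [|left; apply hX]. apply Rmult_le_pos; [lra|apply pow2_ge_0].
Qed.

(** The growth condition on the pressure turns the potential energy, which need
    not be positive, into a bound for the total pressure. *)
Lemma total_pressure_le (X : Z -> R) : (forall j, 0 < dx X j) ->
  0 <= sumn J (fun j => q j (m j / dx X j) * dx X j)
    <= C0 * (sumn J m + potential J m q X).
Proof.
  intros hX.
  assert (hr : forall j, 0 < m j / dx X j).
  { intros j. apply Rdiv_lt_0_compat; [apply fl|apply hX]. }
  split.
  - apply sumn_nonneg. intros j _. apply Rmult_le_pos; [|left; apply hX].
    now apply (fl_q_nonneg _ _ _ _ _ _ _ _ fl).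
  - unfold potential. rewrite <- sumn_plus, <- sumn_scal. apply sumn_le. intros j _.
    pose proof (fl_q_energy _ _ _ _ _ _ _ _ fl j _ (hr j)) as he.
    apply Rle_trans with
      (C0 * (m j / dx X j + m j / dx X j * specific_energy q j (m j / dx X j)) * dx X j).
    + apply Rmult_le_compat_r; [left; apply hX|easy].
    + right. field. specialize (hX j). lra.
Qed.

(** Summation by parts turns the stress into the work of the velocity
    differences; its pressure part is returned by the potential energy. *)
Lemma is_derive_energy (b : R) (x u : R -> Z -> R) (t : R) :
  motion J m nu q b x u -> 0 <= t <= b ->
  is_derive (fun s => kinetic J m (u s) + potential J m q (x s)) t
    (- dissipation J nu (x t) (u t)).
Proof.
  intros hm ht.
  pose proof (fun j => mo_dx_pos _ _ _ _ _ _ _ hm t j ht) as hw.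
  pose proof (fun j => mo_x _ _ _ _ _ _ _ hm t j ht) as hx.
  pose proof (fun j => mo_u _ _ _ _ _ _ _ hm t j ht) as hu.
  pose proof (mo_u_periodic _ _ _ _ _ _ _ hm t ht) as hpu.
  pose proof (stress_periodic (x t) (u t) (mo_x_periodic _ _ _ _ _ _ _ hm t ht) hpu) as hps.
  set (sg := stress m nu q (x t) (u t)) in *.
  assert (hk : is_derive (fun s => kinetic J m (u s)) t
    (- sumn J (fun j => (u t j - u t (j - 1)%Z) * sg j))).
  { rewrite <- (summation_by_parts J (u t) sg hpu hps).
    apply (is_derive_eq _ _ (/ 2 * sumn J (fun j => mass_h m j *
      (2 * u t j * accel m nu q (x t) (u t) j)))).
    - apply is_derive_Rscal, (is_derive_sumn J (fun s j => mass_h m j * u s j ^ 2)).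
      intros j _. apply is_derive_Rscal.
      apply (is_derive_ext (fun s => u s j * u s j)); [intros; simpl; ring|].
      eapply is_derive_eq; [apply is_derive_Rmult; apply hu|]. simpl; ring.
    - rewrite <- sumn_scal. apply sumn_ext. intros j _. unfold accel. fold sg. field.
      pose proof (mass_h_pos j). lra. }
  assert (hp : is_derive (fun s => potential J m q (x s)) t
    (- sumn J (fun j => (u t j - u t (j - 1)%Z) * q j (m j / dx (x t) j)))).
  { apply (is_derive_eq _ _ (sumn J (fun j =>
      m j * (q j (m j / dx (x t) j) / (m j / dx (x t) j) ^ 2 *
             (- (m j / dx (x t) j) * ((u t j - u t (j - 1)%Z) / dx (x t) j)))))).
    - apply (is_derive_sumn J (fun s j => m j * specific_energy q j (m j / dx (x s) j))).
      intros j _. apply is_derive_Rscal.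
      apply (is_derive_Rcomp (specific_energy q j) (fun s => m j / dx (x s) j)).
      + apply is_derive_specific_energy, Rdiv_lt_0_compat; [apply fl|apply hw].
      + apply (is_derive_density (m j) (fun s => dx (x s) j)); [apply hw|].
        now apply is_derive_dx.
    - rewrite <- (Rmult_1_l (sumn J (fun j => _ * q j _))), <- Ropp_mult_distr_l_reverse.
      rewrite <- sumn_scal. apply sumn_ext. intros j _. field.
      pose proof (hw j). pose proof (fl_m_pos _ _ _ _ _ _ _ _ fl j). split; lra. }
  eapply is_derive_eq; [apply is_derive_Rplus; [exact hk|exact hp]|].
  enough (sumn J (fun j => (u t j - u t (j - 1)%Z) * sg j) =
    dissipation J nu (x t) (u t) - sumn J (fun j => (u t j - u t (j - 1)%Z) * q j (m j / dx (x t) j))) by lra.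
  unfold dissipation. rewrite <- sumn_minus. apply sumn_ext. intros j _.
  unfold sg, stress, Du. field. specialize (hw j). lra.
Qed.

(** * Bounds for the density *)

(** The inequality [|y| <= (1 + y^2) / 2], weighted with the masses, gives a bound
    that does not involve the number of cells. *)
Lemma partial_momentum_le (V : Z -> R) (j : Z) : (0 <= j < Z.of_nat J)%Z ->
  Rabs (partial_momentum m V j) <= / 2 * sumn J m + kinetic J m V.
Proof.
  intros hj. unfold partial_momentum, kinetic. eapply Rle_trans; [apply sumn_Rabs|].
  eapply Rle_trans; [apply (sumn_mono _ J); [lia|intros; apply Rabs_pos]|].
  rewrite <- sumn_mass_h, <- Rmult_plus_distr_l, <- sumn_plus, <- sumn_scal.
  apply sumn_le. intros k _. rewrite Rabs_mult, (Rabs_pos_eq (mass_h m k)) by (left; apply mass_h_pos).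
  replace (/ 2 * (mass_h m k + mass_h m k * V k ^ 2)) with (mass_h m k * (/ 2 * (1 + V k ^ 2))) by ring.
  apply Rmult_le_compat_l; [left; apply mass_h_pos|apply Rabs_le_half_square].
Qed.

Lemma mean_momentum_le (X V : Z -> R) (A : R) :
  periodic_lift J X -> (forall j, 0 < dx X j) ->
  (forall j, (0 <= j < Z.of_nat J)%Z -> Rabs (partial_momentum m V j) <= A) ->
  Rabs (mean_momentum J m X V) <= A.
Proof.
  intros hX hw hA. unfold mean_momentum. eapply Rle_trans; [apply sumn_Rabs|].
  replace A with (A * sumn J (dx X)) by (rewrite (sumn_dx J X hX); ring).
  rewrite <- sumn_scal. apply sumn_le. intros j hj.
  rewrite Rabs_mult, (Rabs_pos_eq (dx X j)), Rmult_comm by (left; apply hw).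
  apply Rmult_le_compat_r; [left; apply hw|now apply hA].
Qed.

(** What averaging over the torus adds to the equation of a cell: the mean stress,
    and the rates of change of the weights [dx_i] against the partial momenta. *)
Definition effective_source (X V : Z -> R) : R :=
  - sumn J (fun i => (V i - V (i - 1)%Z) * partial_momentum m V i + dx X i * stress m nu q X V i).

Lemma is_derive_partial_momentum (b : R) (x u : R -> Z -> R) (t : R) (j : Z) :
  motion J m nu q b x u -> 0 <= t <= b -> (0 <= j)%Z ->
  is_derive (fun s => partial_momentum m (u s) j) t
    (stress m nu q (x t) (u t) j - stress m nu q (x t) (u t) 0%Z).
Proof.
  intros hm ht hj. unfold partial_momentum.
  set (sg := stress m nu q (x t) (u t)).
  apply (is_derive_eq _ _ (sumn (Z.to_nat j) (fun k => sg (k + 1)%Z - sg k)));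
    [|now rewrite sumn_telescope, Z2Nat.id].
  apply (is_derive_sumn (Z.to_nat j) (fun s k => mass_h m k * u s k)). intros k _.
  eapply is_derive_eq; [apply is_derive_Rscal, (mo_u _ _ _ _ _ _ _ hm t k ht)|].
  unfold accel. fold sg. field. pose proof (mass_h_pos k). lra.
Qed.

(** Summing the momentum equation from a cell [i] to the cell [j] gives the
    difference of the stresses; averaging over [i] with the weights [dx_i],
    whose sum is 1, leaves only quantities that the energy controls. *)
Lemma is_derive_effective (b : R) (x u : R -> Z -> R) (t : R) (j : Z) :
  motion J m nu q b x u -> 0 <= t <= b -> (0 <= j < Z.of_nat J)%Z ->
  is_derive (fun s => nu j * ln (m j / dx (x s) j) + (partial_momentum m (u s) j - mean_momentum J m (x s) (u s)))
    t (effective_source (x t) (u t) - q j (m j / dx (x t) j)).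
Proof.
  intros hm ht hj.
  pose proof (fun j => mo_dx_pos _ _ _ _ _ _ _ hm t j ht) as hw.
  pose proof (fun j => mo_x _ _ _ _ _ _ _ hm t j ht) as hx.
  pose proof (fl_m_pos _ _ _ _ _ _ _ _ fl) as hmp.
  set (sg := stress m nu q (x t) (u t)).
  eapply is_derive_eq.
  - apply is_derive_Rplus; [apply is_derive_Rscal|apply is_derive_Rminus].
    + apply (is_derive_ln (fun s => m j / dx (x s) j)).
      * apply Rdiv_lt_0_compat; [apply hmp|apply hw].
      * apply (is_derive_density (m j) (fun s => dx (x s) j)); [apply hw|].
        now apply is_derive_dx.
    + apply (is_derive_partial_momentum b x u); [exact hm|exact ht|lia].
    + apply (is_derive_sumn J (fun s i => dx (x s) i * partial_momentum m (u s) i)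
        (fun i => (u t i - u t (i - 1)%Z) * partial_momentum m (u t) i + dx (x t) i * (sg i - sg 0%Z))).
      intros i hi. apply is_derive_Rmult; [now apply is_derive_dx|].
      apply (is_derive_partial_momentum b x u); [exact hm|exact ht|lia].
  - fold sg. unfold effective_source. fold sg.
    rewrite (sumn_ext J (fun i => _ + dx (x t) i * (sg i - sg 0%Z))
      (fun i => ((u t i - u t (i - 1)%Z) * partial_momentum m (u t) i + dx (x t) i * sg i)
                - sg 0%Z * dx (x t) i)) by (intros; ring).
    rewrite sumn_minus, sumn_scal, (sumn_dx J (x t)) by (now apply (mo_x_periodic _ _ _ _ _ _ _ hm)).
    unfold sg at 1. unfold stress, Du. field. split; [apply Rgt_not_eq, hw|apply Rgt_not_eq, hmp].
Qed.

Lemma velocity_variation_le (X V : Z -> R) : periodic_lift J X -> (forall j, 0 < dx X j) ->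
  sumn J (fun i => Rabs (V i - V (i - 1)%Z)) <= / 2 * (1 + sumn J (fun i => Du X V i ^ 2 * dx X i)).
Proof.
  intros hX hw. rewrite <- (sumn_dx J X hX) at 1. rewrite <- sumn_plus, <- sumn_scal.
  apply sumn_le. intros i _. specialize (hw i).
  replace (V i - V (i - 1)%Z) with (Du X V i * dx X i) by (unfold Du; field; lra).
  rewrite Rabs_mult, (Rabs_pos_eq (dx X i)) by lra.
  replace (/ 2 * (dx X i + Du X V i ^ 2 * dx X i)) with ((/ 2 * (1 + Du X V i ^ 2)) * dx X i) by ring.
  apply Rmult_le_compat_r; [lra|apply Rabs_le_half_square].
Qed.

(** The velocity differences add up to at most [(1 + sum of Du^2 dx) / 2], so the
    dissipation, whose time integral the energy bounds, controls them uniformly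
    in the grid. *)
Lemma effective_source_le (X V : Z -> R) (A K : R) :
  periodic_lift J X -> (forall j, 0 < dx X j) -> 0 <= A ->
  (forall j, (0 <= j < Z.of_nat J)%Z -> Rabs (partial_momentum m V j) <= A) ->
  sumn J m + potential J m q X <= K ->
  Rabs (effective_source X V) <=
    C0 * K + (nu_max + A) / 2 + (nu_max + A) / (2 * nu_min) * dissipation J nu X V.
Proof.
  intros hX hw hA hmom hK.
  pose proof (fl_nu _ _ _ _ _ _ _ _ fl) as hnu. pose proof (fl_nu_min _ _ _ _ _ _ _ _ fl) as hnm.
  destruct (total_pressure_le X hw) as [hq0 hq1].
  assert (hC := fl_C0 _ _ _ _ _ _ _ _ fl).
  assert (hqK : C0 * (sumn J m + potential J m q X) <= C0 * K) by (apply Rmult_le_compat_l; lra).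
  assert (hsplit : effective_source X V =
    sumn J (fun j => q j (m j / dx X j) * dx X j)
    - sumn J (fun i => (V i - V (i - 1)%Z) * (partial_momentum m V i + nu i))).
  { unfold effective_source. rewrite <- sumn_minus.
    rewrite <- (Rmult_1_l (sumn J _)), <- Ropp_mult_distr_l_reverse, <- sumn_scal.
    apply sumn_ext. intros i _. unfold stress, Du. field. specialize (hw i). lra. }
  assert (hv : Rabs (sumn J (fun i => (V i - V (i - 1)%Z) * (partial_momentum m V i + nu i))) <=
     (nu_max + A) * sumn J (fun i => Rabs (V i - V (i - 1)%Z))).
  { eapply Rle_trans; [apply sumn_Rabs|]. rewrite <- sumn_scal. apply sumn_le. intros i hi.
    rewrite Rabs_mult, Rmult_comm. apply Rmult_le_compat_r; [apply Rabs_pos|].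
    eapply Rle_trans; [apply Rabs_triang|]. specialize (hmom i hi). specialize (hnu i).
    rewrite (Rabs_pos_eq (nu i)) by lra. lra. }
  assert (hd : sumn J (fun i => Du X V i ^ 2 * dx X i) <= / nu_min * dissipation J nu X V).
  { unfold dissipation. rewrite <- sumn_scal. apply sumn_le. intros i _.
    specialize (hnu i). specialize (hw i).
    apply Rmult_le_reg_l with nu_min; [easy|].
    replace (nu_min * (/ nu_min * (nu i * Du X V i ^ 2 * dx X i))) with
      (nu i * (Du X V i ^ 2 * dx X i)) by (field; lra).
    apply Rmult_le_compat_r; [|lra]. apply Rmult_le_pos; [apply pow2_ge_0|lra]. }
  pose proof (velocity_variation_le X V hX hw) as hvar.
  assert (hnA : 0 <= nu_max + A) by (specialize (hnu 0%Z); lra).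
  rewrite hsplit.
  eapply Rle_trans; [apply Rabs_triang|]. rewrite Rabs_Ropp, (Rabs_pos_eq _ hq0).
  apply Rle_trans with (C0 * K + (nu_max + A) * (/ 2 * (1 + / nu_min * dissipation J nu X V))).
  - apply Rplus_le_compat; [lra|]. eapply Rle_trans; [exact hv|].
    apply Rmult_le_compat_l; lra.
  - right. field. lra.
Qed.

Lemma energy_controls (b K : R) (x u : R -> Z -> R) (t : R) :
  motion J m nu q b x u -> 0 <= t <= b ->
  kinetic J m (u 0) + potential J m q (x 0) + sumn J m <= K ->
  kinetic J m (u t) <= K /\ sumn J m + potential J m q (x t) <= K /\
  0 <= (kinetic J m (u 0) + potential J m q (x 0)) -
       (kinetic J m (u t) + potential J m q (x t)) <= K.
Proof.
  intros hm ht hK.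
  assert (hdec : kinetic J m (u t) + potential J m q (x t) <=
                 kinetic J m (u 0) + potential J m q (x 0)).
  { apply (nonincreasing_of_derive (fun s => kinetic J m (u s) + potential J m q (x s))
      (fun s => - dissipation J nu (x s) (u s)) 0 t); [lra| |].
    - intros s hs. split; [apply (is_derive_energy b); auto; lra|].
      enough (0 <= dissipation J nu (x s) (u s)) by lra.
      apply dissipation_nonneg. intros j. apply (mo_dx_pos _ _ _ _ _ _ _ hm); lra.
    - intros s hs. apply (is_derive_continuous _ _ (- dissipation J nu (x s) (u s))).
      apply (is_derive_energy b); auto; lra. }
  pose proof (kinetic_nonneg (u t)).
  destruct (total_pressure_le (x t)) as [h1 h2].
  { intros j. now apply (mo_dx_pos _ _ _ _ _ _ _ hm). }
  assert (0 <= sumn J m + potential J m q (x t)).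
  { pose proof (fl_C0 _ _ _ _ _ _ _ _ fl). apply Rmult_le_reg_l with C0; lra. }
  lra.
Qed.

(** The effective variable [psi] below satisfies [psi' = source - pressure] with
    an integrable source.  As the pressure is nonnegative this bounds the
    density from above; where the density is below 1 the pressure is bounded,
    so the barrier argument bounds the density from below. *)
Lemma log_density_le (b K : R) (x u : R -> Z -> R) (t : R) (j : Z) :
  motion J m nu q b x u -> 0 <= t <= b -> (0 <= j < Z.of_nat J)%Z ->
  kinetic J m (u 0) + potential J m q (x 0) + sumn J m <= K -> sumn J m <= K ->
  Rabs (nu j * ln (m j / dx (x t) j)) <=
    Rabs (nu j * ln (m j / dx (x 0) j)) + 8 * K
      + (nu_max + 2 * K) / (2 * nu_min) * K
      + (C0 * K + (nu_max + 2 * K) / 2 + P1) * t.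
Proof.
  intros hm ht hj hK hM.
  pose proof (fl_nu _ _ _ _ _ _ _ _ fl) as hnu. pose proof (fl_nu_min _ _ _ _ _ _ _ _ fl) as hnm.
  pose proof (fl_P1 _ _ _ _ _ _ _ _ fl) as hP1. pose proof (fl_C0 _ _ _ _ _ _ _ _ fl) as hC.
  pose proof (mo_dx_pos _ _ _ _ _ _ _ hm) as hw.
  assert (hK0 : 0 <= K).
  { pose proof (kinetic_nonneg (u t)). destruct (energy_controls b K x u t hm ht hK) as [? _]. lra. }
  assert (hW : forall s i, 0 <= s <= b -> (0 <= i < Z.of_nat J)%Z ->
    Rabs (partial_momentum m (u s) i) <= 2 * K).
  { intros s i hs hi. pose proof (partial_momentum_le (u s) i hi).
    destruct (energy_controls b K x u s hm hs hK) as [? _]. lra. }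
  assert (hWd : forall s, 0 <= s <= b ->
    Rabs (partial_momentum m (u s) j - mean_momentum J m (x s) (u s)) <= 4 * K).
  { intros s hs.
    assert (Rabs (mean_momentum J m (x s) (u s)) <= 2 * K).
    { apply mean_momentum_le; [now apply (mo_x_periodic _ _ _ _ _ _ _ hm)| |].
      - intros i. now apply hw.
      - intros i hi. now apply hW. }
    specialize (hW s j hs hj). eapply Rle_trans; [apply Rabs_triang|]. rewrite Rabs_Ropp. lra. }
  set (lr := fun s => nu j * ln (m j / dx (x s) j)).
  set (psi := fun s => lr s + (partial_momentum m (u s) j - mean_momentum J m (x s) (u s))).
  set (en := fun s => kinetic J m (u s) + potential J m q (x s)).
  set (g1 := C0 * K + (nu_max + 2 * K) / 2). set (g2 := (nu_max + 2 * K) / (2 * nu_min)).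
  set (pr := fun s => q j (m j / dx (x s) j)).
  assert (hg1 : 0 <= g1).
  { unfold g1. specialize (hnu j). assert (0 <= C0 * K) by (apply Rmult_le_pos; lra). lra. }
  assert (hg2 : 0 <= g2).
  { unfold g2. specialize (hnu j). apply Rdiv_le_0_compat; lra. }
  set (S := fun s => effective_source (x s) (u s)).
  set (ds := fun s => dissipation J nu (x s) (u s)).
  assert (hS : forall s, 0 <= s <= b -> Rabs (S s) <= g1 + g2 * ds s).
  { intros s hs. unfold S, g1, g2, ds.
    apply effective_source_le; [now apply (mo_x_periodic _ _ _ _ _ _ _ hm)| |lra| |].
    - intros i. now apply hw.
    - intros i hi. now apply hW.
    - now apply (energy_controls b K x u s hm hs hK). }
  assert (hpsi : forall s, 0 <= s <= b -> is_derive psi s (S s - pr s)).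
  { intros s hs. now apply (is_derive_effective b). }
  set (G := fun s => g1 * s + g2 * (en 0 - en s)).
  assert (hG : forall s, 0 <= s <= b -> is_derive G s (g1 + g2 * ds s)).
  { intros s hs. apply (is_derive_eq _ _ (g1 * 1 + g2 * (0 - (- ds s)))); [|ring].
    apply is_derive_Rplus; [apply is_derive_Rscal, is_derive_Rid|].
    apply is_derive_Rscal, is_derive_Rminus; [apply is_derive_Rconst|].
    now apply (is_derive_energy b). }
  assert (hGb : forall s, 0 <= s <= b -> 0 <= G s <= g1 * s + g2 * K).
  { intros s hs. destruct (energy_controls b K x u s hm hs hK) as [_ [_ [h1 h2]]].
    fold (en 0) (en s) in h1, h2. unfold G.
    assert (0 <= g1 * s) by (apply Rmult_le_pos; lra).
    assert (0 <= g2 * (en 0 - en s)) by (apply Rmult_le_pos; lra).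
    assert (g2 * (en 0 - en s) <= g2 * K) by (apply Rmult_le_compat_l; lra). lra. }
  assert (hG0 : G 0 = 0) by (unfold G; ring).
  assert (hpr : forall s, 0 <= s <= b -> 0 <= pr s).
  { intros s hs. apply (fl_q_nonneg _ _ _ _ _ _ _ _ fl), Rdiv_lt_0_compat; [apply fl|now apply hw]. }
  assert (hWt := hWd t ht). assert (hW0 := hWd 0 ltac:(lra)).
  apply Rabs_le_between in hWt, hW0. specialize (hGb t ht).
  assert (hPt : 0 <= P1 * t) by (apply Rmult_le_pos; lra).
  assert (hup : psi t - G t <= psi 0 - G 0).
  { apply (nonincreasing_of_derive (fun s => psi s - G s)
      (fun s => (S s - pr s) - (g1 + g2 * ds s)) 0 t); [lra| |].
    - intros s hs. split; [apply is_derive_Rminus; [apply hpsi|apply hG]; lra|].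
      specialize (hS s ltac:(lra)). apply Rabs_le_between in hS. specialize (hpr s ltac:(lra)). lra.
    - intros s hs. apply (is_derive_continuous _ _ ((S s - pr s) - (g1 + g2 * ds s))).
      apply is_derive_Rminus; [apply hpsi|apply hG]; lra. }
  set (theta := Rmin (psi 0) (- (4 * K))).
  assert (hlow : theta <= psi t + (G t + P1 * t)).
  { apply (barrier (fun s => psi s + (G s + P1 * s))
      (fun s => (S s - pr s) + ((g1 + g2 * ds s) + P1)) theta t); [lra| | |].
    - intros s hs. apply is_derive_Rplus; [apply hpsi; lra|].
      apply is_derive_Rplus; [apply hG; lra|].
      apply (is_derive_eq _ _ (P1 * 1)); [apply is_derive_Rscal, is_derive_Rid|ring].
    - rewrite hG0, Rmult_0_r, Rplus_0_l, Rplus_0_r. apply Rmin_l.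
    - intros s hs hlt.
      (* Below the level [theta] the logarithm of the density is negative. *)
      assert (hlr : lr s < 0).
      { pose proof (Rmin_r (psi 0) (- (4 * K))) as hr. fold theta in hr.
        specialize (hWd s ltac:(lra)). apply Rabs_le_between in hWd.
        assert (0 <= P1 * s) by (apply Rmult_le_pos; lra).
        assert (0 <= G s).
        { destruct (energy_controls b K x u s hm ltac:(lra) hK) as [_ [_ [h1 h2]]].
          fold (en 0) (en s) in h1, h2. unfold G. apply Rplus_le_le_0_compat; apply Rmult_le_pos; lra. }
        unfold psi in hlt. lra. }
      assert (hrho : 0 < m j / dx (x s) j).
      { apply Rdiv_lt_0_compat; [apply fl|apply hw; lra]. }
      assert (hsm : pr s <= P1).
      { apply (fl_q_small _ _ _ _ _ _ _ _ fl). split; [easy|].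
        apply Rnot_lt_le. intros hc. apply ln_increasing in hc; [|lra]. rewrite ln_1 in hc.
        unfold lr in hlr. specialize (hnu j).
        assert (0 <= nu j * ln (m j / dx (x s) j)) by (apply Rmult_le_pos; lra). lra. }
      specialize (hS s ltac:(lra)). apply Rabs_le_between in hS. lra. }
  rewrite hG0 in hup. fold (lr t) (lr 0) g1 g2.
  assert (hl0 : - Rabs (lr 0) <= lr 0 <= Rabs (lr 0)) by (apply Rabs_le_between; lra).
  pose proof (Rabs_pos (lr 0)) as hl1.
  assert (htheta : - Rabs (lr 0) - 4 * K <= theta).
  { unfold theta. apply Rmin_glb; [unfold psi; lra|lra]. }
  apply Rabs_le. unfold psi in *. lra.
Qed.

End Fluid.


(** * Motions on bounded time intervals *)

Definition locally_lipschitz_laws (q : Z -> R -> R) : Prop :=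
  forall b, 0 < b -> exists Q L, 0 <= Q /\ 0 <= L /\ forall j r s,
    0 < r <= b -> 0 < s <= b ->
    Rabs (q j r) <= Q /\ Rabs (q j r - q j s) <= L * Rabs (r - s).

(** The state of the system; [inl] carries the positions and [inr] the
    velocities.  The field is truncated: velocities enter through their
    projection on [[- U, U]] and cells through [Rmax delta dx], which makes it
    bounded and globally Lipschitz. *)
Definition tr_velocity (U : R) (a : Z + Z -> R) (j : Z) : R := clamp (- U) U (a (inr j)).

Definition tr_inv_dx (delta : R) (a : Z + Z -> R) (j : Z) : R :=
  / Rmax delta (dx (fun k => a (inl k)) j).

Definition tr_stress (m nu : Z -> R) (q : Z -> R -> R) (delta U : R)
    (a : Z + Z -> R) (j : Z) : R :=
  nu j * ((tr_velocity U a j - tr_velocity U a (j - 1)%Z) * tr_inv_dx delta a j)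
  - q j (m j * tr_inv_dx delta a j).

Definition tr_field (m nu : Z -> R) (q : Z -> R -> R) (delta U : R)
    (a : Z + Z -> R) (i : Z + Z) : R :=
  match i with
  | inl j => tr_velocity U a j
  | inr j => (tr_stress m nu q delta U a (j + 1)%Z - tr_stress m nu q delta U a j)
               / mass_h m j
  end.

Definition state (X V : Z -> R) (i : Z + Z) : R :=
  match i with inl j => X j | inr j => V j end.

Definition in_box (delta U : R) (X V : Z -> R) : Prop :=
  forall j, delta <= dx X j /\ - U <= V j <= U.

Lemma tr_stress_in_box m nu q delta U X V (j : Z) :
  in_box delta U X V -> tr_stress m nu q delta U (state X V) j = stress m nu q X V j.
Proof.
  intros h. unfold tr_stress, tr_velocity, tr_inv_dx, stress, Du; simpl.
  rewrite !clamp_id by apply h. rewrite Rmax_right by apply (h j). reflexivity.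
Qed.

Lemma tr_field_in_box m nu q delta U X V (i : Z + Z) :
  in_box delta U X V ->
  tr_field m nu q delta U (state X V) i = state V (accel m nu q X V) i.
Proof.
  intros h. destruct i as [j|j]; simpl.
  - unfold tr_velocity; simpl. apply clamp_id, h.
  - unfold accel. now rewrite !tr_stress_in_box.
Qed.

Lemma tr_inv_dx_bounds (delta : R) (a : Z + Z -> R) (j : Z) :
  0 < delta -> 0 < tr_inv_dx delta a j <= / delta.
Proof.
  intros hd. unfold tr_inv_dx. pose proof (Rmax_l delta (dx (fun k => a (inl k)) j)).
  split; [apply Rinv_0_lt_compat; lra|apply Rinv_le_contravar; lra].
Qed.

Lemma tr_inv_dx_lipschitz (delta d : R) (a b : Z + Z -> R) (j : Z) :
  0 < delta -> (forall i, Rabs (a i - b i) <= d) ->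
  Rabs (tr_inv_dx delta a j - tr_inv_dx delta b j) <= 2 / delta ^ 2 * d.
Proof.
  intros hd h. pose proof (tr_inv_dx_bounds delta a j hd) as ha.
  pose proof (tr_inv_dx_bounds delta b j hd) as hb. unfold tr_inv_dx in *.
  set (wa := Rmax delta (dx (fun k => a (inl k)) j)) in *.
  set (wb := Rmax delta (dx (fun k => b (inl k)) j)) in *.
  assert (hwa : delta <= wa) by apply Rmax_l. assert (hwb : delta <= wb) by apply Rmax_l.
  assert (hw : Rabs (wb - wa) <= 2 * d).
  { pose proof (h (inl j)) as h1. pose proof (h (inl (j - 1)%Z)) as h2.
    unfold wa, wb, dx. revert h1 h2. clear.
    unfold Rmax, Rabs; repeat destruct Rle_dec; repeat destruct Rcase_abs; lra. }
  replace (/ wa - / wb) with ((wb - wa) * (/ wa * / wb)) by (field; lra).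
  rewrite Rabs_mult, (Rabs_pos_eq (/ wa * / wb)) by (apply Rmult_le_pos; lra).
  replace (2 / delta ^ 2 * d) with ((2 * d) * (/ delta * / delta)) by (field; lra).
  apply Rmult_le_compat; [apply Rabs_pos|apply Rmult_le_pos; lra|easy|].
  apply Rmult_le_compat; lra.
Qed.

Lemma Rabs_mult_diff (a b c d A B e1 e2 : R) :
  Rabs (a - c) <= e1 -> Rabs (b - d) <= e2 -> Rabs b <= B -> Rabs c <= A ->
  Rabs (a * b - c * d) <= e1 * B + A * e2.
Proof.
  intros h1 h2 h3 h4. replace (a * b - c * d) with ((a - c) * b + c * (b - d)) by ring.
  eapply Rle_trans; [apply Rabs_triang|]. rewrite !Rabs_mult.
  apply Rplus_le_compat; apply Rmult_le_compat; auto using Rabs_pos.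
Qed.

Section Motion.

Context (J : nat) (m nu : Z -> R) (q : Z -> R -> R) (nu_min nu_max C0 P1 : R).
Context (fl : fluid J m nu q nu_min nu_max C0 P1).
Context (hq : locally_lipschitz_laws q).

Lemma tr_field_lipschitz (delta U : R) : 0 < delta -> 0 < U ->
  exists L B, 0 < L /\ 0 <= B /\ sup_lipschitz L (tr_field m nu q delta U) /\
    forall a i, Rabs (tr_field m nu q delta U a i) <= B.
Proof.
  intros hd hU.
  destruct (periodic_upper_bound J m (fl_J _ _ _ _ _ _ _ _ fl) (fl_m_periodic _ _ _ _ _ _ _ _ fl))
    as [mx [hmx0 hmx]].
  destruct (periodic_lower_bound J m (fl_J _ _ _ _ _ _ _ _ fl) (fl_m_periodic _ _ _ _ _ _ _ _ fl)
    (fl_m_pos _ _ _ _ _ _ _ _ fl)) as [ml [hml0 hml]].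
  pose proof (fl_nu _ _ _ _ _ _ _ _ fl) as hnu. pose proof (fl_nu_min _ _ _ _ _ _ _ _ fl) as hnm.
  assert (hid : 0 < / delta) by now apply Rinv_0_lt_compat.
  destruct (hq ((mx + 1) * / delta)) as [Q [Lq [hQ0 [hLq0 hql]]]].
  { apply Rmult_lt_0_compat; lra. }
  assert (hmb : forall j, ml <= mass_h m j).
  { intros j. unfold mass_h. pose proof (hml j). pose proof (hml (j + 1)%Z). lra. }
  assert (hr : forall a j, 0 < m j * tr_inv_dx delta a j <= (mx + 1) * / delta).
  { intros a j. pose proof (tr_inv_dx_bounds delta a j hd). specialize (hmx j). specialize (hml j).
    rewrite Rabs_pos_eq in hmx by lra.
    split; [apply Rmult_lt_0_compat; lra|apply Rmult_le_compat; lra]. }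
  assert (hv : forall a j, Rabs (tr_velocity U a j - tr_velocity U a (j - 1)%Z) <= 2 * U).
  { intros a j. unfold tr_velocity. pose proof (clamp_bounds (- U) U (a (inr j)) ltac:(lra)).
    pose proof (clamp_bounds (- U) U (a (inr (j - 1)%Z)) ltac:(lra)). apply Rabs_le. lra. }
  set (Ls := nu_max * (2 * / delta + 2 * U * (2 / delta ^ 2)) + Lq * (mx * (2 / delta ^ 2))).
  set (Bs := nu_max * (2 * U * / delta) + Q).
  assert (hd2 : 0 < 2 / delta ^ 2) by (apply Rdiv_lt_0_compat; [lra|apply pow_lt; lra]).
  assert (hnx : 0 < nu_max) by (specialize (hnu 0%Z); lra).
  assert (hLs : 0 <= Ls).
  { unfold Ls. apply Rplus_le_le_0_compat.
    - apply Rmult_le_pos; [lra|]. apply Rplus_le_le_0_compat; [lra|]. apply Rmult_le_pos; lra.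
    - apply Rmult_le_pos; [lra|]. apply Rmult_le_pos; lra. }
  assert (hBs : 0 <= Bs).
  { unfold Bs. apply Rplus_le_le_0_compat; [|lra]. apply Rmult_le_pos; [lra|].
    apply Rmult_le_pos; lra. }
  assert (hsl : forall a b d, (forall i, Rabs (a i - b i) <= d) -> forall j,
    Rabs (tr_stress m nu q delta U a j - tr_stress m nu q delta U b j) <= Ls * d).
  { intros a b d h j. pose proof (tr_inv_dx_lipschitz delta d a b j hd h) as hi.
    assert (hd0 : 0 <= d) by (eapply Rle_trans; [apply Rabs_pos|apply (h (inl j))]).
    unfold tr_stress.
    assert (h1 : Rabs ((tr_velocity U a j - tr_velocity U a (j - 1)%Z) * tr_inv_dx delta a j -
       (tr_velocity U b j - tr_velocity U b (j - 1)%Z) * tr_inv_dx delta b j)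
       <= (2 * d) * / delta + (2 * U) * (2 / delta ^ 2 * d)).
    { apply Rabs_mult_diff; auto.
      - unfold tr_velocity.
        pose proof (clamp_lipschitz (- U) U (a (inr j)) (b (inr j))) as c1.
        pose proof (clamp_lipschitz (- U) U (a (inr (j - 1)%Z)) (b (inr (j - 1)%Z))) as c2.
        pose proof (h (inr j)) as c3. pose proof (h (inr (j - 1)%Z)) as c4.
        assert (c5 := Rle_trans _ _ _ c1 c3). assert (c6 := Rle_trans _ _ _ c2 c4).
        apply Rabs_le_between in c5, c6. apply Rabs_le. lra.
      - pose proof (tr_inv_dx_bounds delta a j hd). rewrite Rabs_pos_eq; lra. }
    assert (h2 : Rabs (q j (m j * tr_inv_dx delta a j) - q j (m j * tr_inv_dx delta b j))
       <= Lq * (mx * (2 / delta ^ 2 * d))).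
    { eapply Rle_trans; [apply (hql j); apply hr|]. apply Rmult_le_compat_l; [easy|].
      rewrite <- Rmult_minus_distr_l, Rabs_mult.
      apply Rmult_le_compat; auto using Rabs_pos. }
    match goal with |- Rabs (?n * ?p - ?r - (?n * ?p' - ?r')) <= _ =>
      replace (n * p - r - (n * p' - r')) with (n * (p - p') - (r - r')) by ring end.
    eapply Rle_trans; [apply Rabs_triang|]. rewrite Rabs_Ropp, Rabs_mult.
    specialize (hnu j). rewrite (Rabs_pos_eq (nu j)) by lra.
    apply Rle_trans with (nu_max * ((2 * d) * / delta + (2 * U) * (2 / delta ^ 2 * d))
       + Lq * (mx * (2 / delta ^ 2 * d))).
    - apply Rplus_le_compat; [|exact h2]. apply Rmult_le_compat; auto using Rabs_pos; lra.
    - right. unfold Ls. ring. }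
  assert (hsb : forall a j, Rabs (tr_stress m nu q delta U a j) <= Bs).
  { intros a j. unfold tr_stress, Bs. eapply Rle_trans; [apply Rabs_triang|].
    rewrite Rabs_Ropp, !Rabs_mult. specialize (hnu j). rewrite (Rabs_pos_eq (nu j)) by lra.
    pose proof (tr_inv_dx_bounds delta a j hd). rewrite (Rabs_pos_eq (tr_inv_dx delta a j)) by lra.
    apply Rplus_le_compat.
    - apply Rmult_le_compat; [lra| |lra|].
      + apply Rmult_le_pos; [apply Rabs_pos|lra].
      + apply Rmult_le_compat; [apply Rabs_pos|lra|apply hv|lra].
    - apply (hql j _ _ (hr a j) (hr a j)). }
  assert (hdiv : forall c c' e j, Rabs c <= e -> Rabs c' <= e -> Rabs ((c - c') / mass_h m j) <= 2 * e / ml).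
  { intros c c' e j h1 h2. specialize (hmb j). unfold Rdiv.
    rewrite Rabs_mult, (Rabs_pos_eq (/ mass_h m j)) by (left; apply Rinv_0_lt_compat; lra).
    apply Rmult_le_compat; [apply Rabs_pos|left; apply Rinv_0_lt_compat; lra| |].
    - eapply Rle_trans; [apply Rabs_triang|]. rewrite Rabs_Ropp. lra.
    - apply Rinv_le_contravar; lra. }
  exists (1 + 2 * Ls / ml), (U + 2 * Bs / ml).
  assert (hL1 : 0 <= 2 * Ls / ml) by (apply Rdiv_le_0_compat; lra).
  assert (hB1 : 0 <= 2 * Bs / ml) by (apply Rdiv_le_0_compat; lra).
  split; [lra|split; [lra|split]].
  - intros a b d h [j|j]; simpl.
    + assert (hd0 : 0 <= d) by (eapply Rle_trans; [apply Rabs_pos|apply (h (inl j))]).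
      eapply Rle_trans; [apply clamp_lipschitz|]. eapply Rle_trans; [apply h|].
      assert (0 <= 2 * Ls / ml * d) by (apply Rmult_le_pos; lra). lra.
    + assert (hd0 : 0 <= d) by (eapply Rle_trans; [apply Rabs_pos|apply (h (inl j))]).
      match goal with |- Rabs ((?p - ?r) / ?n - (?p' - ?r') / ?n) <= _ =>
        replace ((p - r) / n - (p' - r') / n) with (((p - p') - (r - r')) / n)
          by (field; specialize (hmb j); lra) end.
      eapply Rle_trans; [apply (hdiv _ _ (Ls * d)); now apply hsl|].
      replace (2 * (Ls * d) / ml) with (2 * Ls / ml * d) by (field; lra). lra.
  - intros a [j|j]; simpl.
    + pose proof (clamp_bounds (- U) U (a (inr j)) ltac:(lra)). unfold tr_velocity.
      apply Rabs_le. lra.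
    + eapply Rle_trans; [apply (hdiv _ _ Bs); apply hsb|]. lra.
Qed.

(** Translation by one period; on positions it is combined with the shift by
    the length of the torus. *)
Definition translate (a : Z + Z -> R) (i : Z + Z) : R :=
  match i with
  | inl j => a (inl (j + Z.of_nat J)%Z) - 1
  | inr j => a (inr (j + Z.of_nat J)%Z)
  end.

Definition translate_rate (a : Z + Z -> R) (i : Z + Z) : R :=
  match i with
  | inl j => a (inl (j + Z.of_nat J)%Z)
  | inr j => a (inr (j + Z.of_nat J)%Z)
  end.

Lemma tr_field_translate (delta U : R) (a : Z + Z -> R) (i : Z + Z) :
  tr_field m nu q delta U (translate a) i = translate_rate (tr_field m nu q delta U a) i.
Proof.
  assert (hs : forall j, tr_stress m nu q delta U (translate a) j =
                         tr_stress m nu q delta U a (j + Z.of_nat J)%Z).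
  { intros j. unfold tr_stress, tr_velocity, tr_inv_dx, dx; simpl.
    replace (j - 1 + Z.of_nat J)%Z with (j + Z.of_nat J - 1)%Z by lia.
    rewrite (fl_nu_periodic _ _ _ _ _ _ _ _ fl), (fl_m_periodic _ _ _ _ _ _ _ _ fl).
    rewrite (fl_q_periodic _ _ _ _ _ _ _ _ fl _ j).
    match goal with |- context [?p - 1 - (?r - 1)] =>
      replace (p - 1 - (r - 1)) with (p - r) by ring end. reflexivity. }
  destruct i as [j|j]; simpl; [reflexivity|]. rewrite !hs. unfold mass_h.
  replace (j + Z.of_nat J + 1)%Z with (j + 1 + Z.of_nat J)%Z by lia.
  now rewrite !(fl_m_periodic _ _ _ _ _ _ _ _ fl).
Qed.

Lemma tr_motion_exists (delta U : R) (X V : Z -> R) : 0 < delta -> 0 < U ->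
  periodic_lift J X -> periodic J V ->
  exists x u : R -> Z -> R,
    (forall j, x 0 j = X j) /\ (forall j, u 0 j = V j) /\
    (forall t, 0 <= t -> periodic_lift J (x t) /\ periodic J (u t)) /\
    (forall t j, 0 <= t -> is_derive (fun s => x s j) t
       (tr_field m nu q delta U (state (x t) (u t)) (inl j))) /\
    (forall t j, 0 <= t -> is_derive (fun s => u s j) t
       (tr_field m nu q delta U (state (x t) (u t)) (inr j))).
Proof.
  intros hd hU hX hV.
  destruct (tr_field_lipschitz delta U hd hU) as [L [B [hL [hB [hlip hbd]]]]].
  set (F := tr_field m nu q delta U) in *.
  destruct (picard (Z + Z) F L B (state X V) hL hB hlip hbd) as [Y [hY0 hY]].
  assert (hst : forall t i, Y t i = state (fun j => Y t (inl j)) (fun j => Y t (inr j)) i).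
  { now intros t [j|j]. }
  assert (hFst : forall t i, F (Y t) i = F (state (fun j => Y t (inl j)) (fun j => Y t (inr j))) i).
  { now intros t [j|j]. }
  assert (hper : forall b t i, 0 <= t <= b -> Y t i = translate (Y t) i).
  { intros b t i ht.
    assert (hgrow : forall s i, 0 <= s -> Rabs (Y s i - Y 0 i) <= B / (2 * L) * exp (2 * L * s)).
    { intros s k hs. apply (exponential_growth (fun _ => True) (fun r => Y r k) (fun r => F (Y r) k)); auto.
      intros r hr. split; [apply is_derive_has_deriv_on; apply hY; lra|].
      eapply Rle_trans; [apply hbd|]. rewrite <- (Rmult_1_r B) at 1.
      apply Rmult_le_compat_l; [easy|]. pose proof (exp_ineq1_le (2 * L * r)).
      assert (0 <= 2 * L * r) by (apply Rmult_le_pos; lra). lra. }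
    assert (h0 : forall k, Y 0 k = translate (Y 0) k).
    { intros [k|k]; simpl; rewrite !hY0; simpl; [rewrite hX; ring|now rewrite hV]. }
    apply (ode_unique (Z + Z) F (fun _ => True) L b (2 * (B / (2 * L) * exp (2 * L * b)))
             Y (fun s => translate (Y s))); auto; [lra| | |].
    - intros s k hs. apply is_derive_has_deriv_on. apply hY; lra.
    - intros s k hs. apply is_derive_has_deriv_on. unfold F at 1. rewrite tr_field_translate. fold F.
      destruct k as [k|k]; simpl.
      + apply (is_derive_eq _ _ (F (Y s) (inl (k + Z.of_nat J)%Z) - 0)); [|apply Rminus_0_r].
        apply is_derive_Rminus; [apply hY; lra|apply is_derive_Rconst].
      + apply hY; lra.
    - intros s k hs.
      assert (hE : B / (2 * L) * exp (2 * L * s) <= B / (2 * L) * exp (2 * L * b)).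
      { apply Rmult_le_compat_l; [apply Rdiv_le_0_compat; lra|].
        destruct (Req_dec s b) as [->|]; [lra|]. left. apply exp_increasing.
        apply Rmult_lt_compat_l; lra. }
      assert (h1 := hgrow s k ltac:(lra)).
      assert (h2 : Rabs (translate (Y s) k - translate (Y 0) k) <= B / (2 * L) * exp (2 * L * s)).
      { destruct k as [k|k]; simpl; [|apply hgrow; lra].
        match goal with |- Rabs (?p - 1 - (?r - 1)) <= _ =>
          replace (p - 1 - (r - 1)) with (p - r) by ring end. apply hgrow; lra. }
      rewrite <- h0 in h2. apply Rabs_le_between in h1, h2. apply Rabs_le. lra. }
  exists (fun t j => Y t (inl j)), (fun t j => Y t (inr j)).
  split; [intros; now rewrite hY0|split; [intros; now rewrite hY0|]].
  split; [|split].
  - intros t ht. split; intros j.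
    + rewrite (hper t t (inl j)) by lra. simpl. ring.
    + now rewrite (hper t t (inr j)) by lra.
  - intros t j ht. fold F. rewrite <- hFst. now apply hY.
  - intros t j ht. fold F. rewrite <- hFst. now apply hY.
Qed.

Lemma uniform_neighbourhood (n : nat) (t : R) (A : Z -> R -> Prop) :
  (forall j, exists e, 0 < e /\ forall s, Rabs (s - t) < e -> A j s) ->
  exists e, 0 < e /\ forall s j, (0 <= j < Z.of_nat n)%Z -> Rabs (s - t) < e -> A j s.
Proof.
  intros h. induction n as [|n [e [he IH]]]; [exists 1; split; [lra|intros; lia]|].
  destruct (h (Z.of_nat n)) as [e' [he' h']]. exists (Rmin e e').
  split; [now apply Rmin_pos|]. intros s j hj hs.
  pose proof (Rmin_l e e'). pose proof (Rmin_r e e').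
  destruct (Z.eq_dec j (Z.of_nat n)) as [->|hne]; [apply h'; lra|apply IH; [lia|lra]].
Qed.

Lemma continuous_le_limit (f : R -> R) (c t : R) : 0 < t -> continuous f t ->
  (forall s, 0 <= s < t -> c <= f s) -> c <= f t.
Proof.
  intros ht hf h. apply Rnot_lt_le. intros hc.
  destruct (continuous_eps_inv f t hf (c - f t)) as [e [he h1]]; [lra|].
  set (s := t - Rmin (e / 2) (t / 2)).
  assert (0 < Rmin (e / 2) (t / 2)) by (apply Rmin_pos; lra).
  pose proof (Rmin_l (e / 2) (t / 2)). pose proof (Rmin_r (e / 2) (t / 2)).
  assert (hs : Rabs (s - t) < e) by (apply Rabs_def1; unfold s; lra).
  specialize (h1 s hs). apply Rabs_def2 in h1. specialize (h s ltac:(unfold s; lra)). lra.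
Qed.

Lemma velocity_le (V : Z -> R) (K ml U : R) (j : Z) :
  0 < ml -> (forall j, ml <= m j) -> periodic J V ->
  kinetic J m V <= K -> U = 1 + 2 * K / ml -> - U < V j < U.
Proof.
  intros hml0 hml hV hK hU.
  assert (hK0 : 0 <= K) by (pose proof (kinetic_nonneg J m nu q _ _ _ _ fl V); lra).
  assert (hr : 0 <= 2 * K / ml) by (apply Rdiv_le_0_compat; lra).
  revert j. apply (periodic_forall J V (fun v => - U < v < U)); [apply fl|easy|].
  intros j hj.
  assert (hs : mass_h m j * V j ^ 2 <= 2 * K).
  { apply Rle_trans with (sumn J (fun j => mass_h m j * V j ^ 2)); [|unfold kinetic in hK; lra].
    apply (sumn_term_le J (fun j => mass_h m j * V j ^ 2)); [|easy]. intros i _.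
    apply Rmult_le_pos; [left; apply (mass_h_pos J m nu q _ _ _ _ fl)|apply pow2_ge_0]. }
  assert (hmj : ml <= mass_h m j).
  { unfold mass_h. pose proof (hml j). pose proof (hml (j + 1)%Z). lra. }
  assert (hv : V j ^ 2 <= 2 * K / ml).
  { apply Rmult_le_reg_l with ml; [easy|]. replace (ml * (2 * K / ml)) with (2 * K) by (field; lra).
    eapply Rle_trans; [|exact hs]. apply Rmult_le_compat_r; [apply pow2_ge_0|easy]. }
  split; apply Rnot_le_lt; intros hc; nra.
Qed.

Lemma dx_ge_of_log_density (X : Z -> R) (ml A : R) (j : Z) :
  (forall j, ml <= m j) -> 0 < ml -> 0 < dx X j ->
  Rabs (nu j * ln (m j / dx X j)) <= A -> ml * exp (- (A / nu_min)) <= dx X j.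
Proof.
  intros hml hml0 hX hA.
  pose proof (fl_nu _ _ _ _ _ _ _ _ fl j) as hnu. pose proof (fl_nu_min _ _ _ _ _ _ _ _ fl) as hnm.
  specialize (hml j).
  assert (hr : 0 < m j / dx X j) by (apply Rdiv_lt_0_compat; lra).
  assert (hl : ln (m j / dx X j) <= A / nu_min).
  { apply Rle_trans with (Rabs (ln (m j / dx X j))); [apply Rle_abs|].
    rewrite Rabs_mult, (Rabs_pos_eq (nu j)) in hA by lra.
    apply Rmult_le_reg_l with nu_min; [easy|].
    replace (nu_min * (A / nu_min)) with A by (field; lra).
    eapply Rle_trans; [|exact hA]. apply Rmult_le_compat_r; [apply Rabs_pos|lra]. }
  assert (he : m j / dx X j <= exp (A / nu_min)).
  { rewrite <- (exp_ln (m j / dx X j)) by easy. destruct hl as [hl|hl]; [left; now apply exp_increasing|right; now rewrite hl]. }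
  pose proof (exp_pos (A / nu_min)) as hep. rewrite exp_Ropp.
  apply Rmult_le_reg_r with (exp (A / nu_min)); [easy|].
  replace (ml * / exp (A / nu_min) * exp (A / nu_min)) with ml by (field; lra).
  apply Rle_trans with (dx X j * (m j / dx X j)).
  - replace (dx X j * (m j / dx X j)) with (m j) by (field; lra). easy.
  - apply Rmult_le_compat_l; lra.
Qed.

(** The truncation is removed by the a priori bounds: as long as the state stays
    in the box the truncated motion is a true motion, so it stays in the
    interior of the box. *)
Theorem motion_exists (X V : Z -> R) (b : R) :
  0 <= b -> periodic_lift J X -> periodic J V -> (forall j, 0 < dx X j) ->
  exists x u, motion J m nu q b x u /\ (forall j, x 0 j = X j) /\ (forall j, u 0 j = V j).
Proof.
  intros hb hX hV hw.
  destruct (periodic_lower_bound J m (fl_J _ _ _ _ _ _ _ _ fl) (fl_m_periodic _ _ _ _ _ _ _ _ fl)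
    (fl_m_pos _ _ _ _ _ _ _ _ fl)) as [ml [hml0 hml]].
  set (K := Rmax (kinetic J m V + potential J m q X + sumn J m) (sumn J m)).
  assert (hK1 : kinetic J m V + potential J m q X + sumn J m <= K) by apply Rmax_l.
  assert (hK2 : sumn J m <= K) by apply Rmax_r.
  assert (hkin : kinetic J m V <= K).
  { destruct (total_pressure_le J m nu q _ _ _ _ fl X hw) as [h1 h2].
    assert (0 <= sumn J m + potential J m q X); [|lra].
    pose proof (fl_C0 _ _ _ _ _ _ _ _ fl). apply Rmult_le_reg_l with C0; lra. }
  destruct (periodic_upper_bound J (fun j => nu j * ln (m j / dx X j)) (fl_J _ _ _ _ _ _ _ _ fl))
    as [l0 [_ hl0]].
  { intros j. now rewrite (fl_nu_periodic _ _ _ _ _ _ _ _ fl), (fl_m_periodic _ _ _ _ _ _ _ _ fl),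
      (dx_periodic J X hX). }
  set (g := C0 * K + (nu_max + 2 * K) / 2 + P1).
  set (A := l0 + 8 * K + (nu_max + 2 * K) / (2 * nu_min) * K + g * b).
  pose proof (fl_nu _ _ _ _ _ _ _ _ fl 0%Z) as hnu. pose proof (fl_nu_min _ _ _ _ _ _ _ _ fl) as hnm.
  pose proof (fl_P1 _ _ _ _ _ _ _ _ fl) as hP1. pose proof (fl_C0 _ _ _ _ _ _ _ _ fl) as hC.
  assert (hK0 : 0 <= K) by (pose proof (kinetic_nonneg J m nu q _ _ _ _ fl V); lra).
  assert (hg0 : 0 <= g).
  { unfold g. assert (0 <= C0 * K) by (apply Rmult_le_pos; lra). lra. }
  assert (hg2 : 0 <= (nu_max + 2 * K) / (2 * nu_min) * K).
  { apply Rmult_le_pos; [apply Rdiv_le_0_compat; lra|lra]. }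
  assert (hgb : 0 <= g * b) by (apply Rmult_le_pos; lra).
  set (delta := ml * exp (- (A / nu_min)) / 2).
  assert (hd : 0 < delta).
  { unfold delta. pose proof (exp_pos (- (A / nu_min))).
    assert (0 < ml * exp (- (A / nu_min))) by now apply Rmult_lt_0_compat. lra. }
  set (U := 1 + 2 * K / ml).
  assert (hU : 0 < U).
  { unfold U. assert (0 <= 2 * K / ml) by (apply Rdiv_le_0_compat; lra). lra. }
  destruct (tr_motion_exists delta U X V hd hU hX hV) as [x [u [hx0 [hu0 [hper [hx hu]]]]]].
  assert (dx0 : forall j, dx (x 0) j = dx X j) by (intros j; unfold dx; now rewrite !hx0).
  assert (hdxc : forall t j, 0 <= t -> continuous (fun s => dx (x s) j) t).
  { intros t j ht. eapply is_derive_continuous. apply is_derive_Rminus; now apply hx. }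
  assert (huc : forall t j, 0 <= t -> continuous (fun s => u s j) t).
  { intros t j ht. eapply is_derive_continuous. now apply hu. }
  assert (hmotion : forall t, (forall s, 0 <= s <= t -> in_box delta U (x s) (u s)) ->
    motion J m nu q t x u).
  { intros t hbox. split.
    - intros s hs. now apply hper.
    - intros s hs. now apply hper.
    - intros s j hs. destruct (hbox s hs j). lra.
    - intros s j hs. apply (is_derive_eq _ _ _ _ (hx s j (proj1 hs))).
      now rewrite tr_field_in_box by now apply hbox.
    - intros s j hs. apply (is_derive_eq _ _ _ _ (hu s j (proj1 hs))).
      now rewrite tr_field_in_box by now apply hbox. }
  assert (e0 : kinetic J m (u 0) + potential J m q (x 0) + sumn J m =
               kinetic J m V + potential J m q X + sumn J m).
  { f_equal. f_equal.
    - unfold kinetic. f_equal. apply sumn_ext. intros j _. now rewrite hu0.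
    - unfold potential. apply sumn_ext. intros j _. now rewrite dx0. }
  set (inside := fun t => forall j, delta < dx (x t) j /\ - U < u t j < U).
  assert (h0 : inside 0).
  { intros j. split.
    - apply Rlt_le_trans with (2 * delta); [lra|].
      unfold delta. rewrite dx0. unfold Rdiv. rewrite <- Rmult_assoc, (Rmult_comm 2), Rmult_assoc.
      replace (2 * / 2) with 1 by field. rewrite Rmult_1_r.
      apply dx_ge_of_log_density; auto. eapply Rle_trans; [apply hl0|]. unfold A. lra.
    - rewrite hu0. now apply (velocity_le V K ml). }
  assert (hin : forall t, 0 <= t <= b -> (forall s, 0 <= s <= t -> in_box delta U (x s) (u s)) ->
    inside t).
  { intros t ht hbox. pose proof (hmotion t hbox) as hm. intros j. split.
    - apply Rlt_le_trans with (2 * delta); [lra|].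
      unfold delta. unfold Rdiv. rewrite <- Rmult_assoc, (Rmult_comm 2), Rmult_assoc.
      replace (2 * / 2) with 1 by field. rewrite Rmult_1_r.
      destruct (periodic_reduce J j (fl_J _ _ _ _ _ _ _ _ fl)) as [k [hk ek]].
      rewrite (ek _ (dx_periodic J (x t) (proj1 (hper t (proj1 ht))))).
      assert (hwk : 0 < dx (x t) k) by (apply (mo_dx_pos _ _ _ _ _ _ _ hm); lra).
      apply dx_ge_of_log_density; auto.
      eapply Rle_trans.
      + apply (log_density_le J m nu q _ _ _ _ fl t K x u t k hm); try lra; easy.
      + fold g. rewrite dx0. specialize (hl0 k). unfold A.
        assert (g * t <= g * b) by (apply Rmult_le_compat_l; lra). lra.
    - apply (velocity_le (u t) K ml); auto; [now apply hper|].
      apply (energy_controls J m nu q _ _ _ _ fl t K x u t hm); lra. }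
  enough (hall : forall t, 0 <= t <= b -> 0 <= t -> in_box delta U (x t) (u t)).
  { exists x, u. split; [|easy]. apply hmotion. intros s hs. apply hall; lra. }
  apply (continuous_induction (fun t => 0 <= t -> in_box delta U (x t) (u t)) b). intros t ht hpre.
  assert (hcl : forall s, 0 <= s <= t -> in_box delta U (x s) (u s)).
  { intros s hs. destruct (Rlt_le_dec s t) as [hlt|hle]; [apply hpre; lra|].
    replace s with t by lra. destruct (Req_dec t 0) as [->|hne].
    - intros j. destruct (h0 j). lra.
    - intros j. split; [|split].
      + apply (continuous_le_limit (fun s => dx (x s) j)); [lra|now apply hdxc|].
        intros r hr. apply (hpre r hr (proj1 hr)).
      + apply (continuous_le_limit (fun s => u s j)); [lra|now apply huc|].
        intros r hr. apply (hpre r hr (proj1 hr)).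
      + enough (- U <= - u t j) by lra.
        apply (continuous_le_limit (fun s => - u s j)); [lra| |].
        * apply (continuous_opp (V := R_NormedModule) (fun s => u s j)). now apply huc.
        * intros r hr. destruct (hpre r hr (proj1 hr) j). lra. }
  pose proof (hin t ht hcl) as hint.
  destruct (uniform_neighbourhood J t
    (fun j s => delta <= dx (x s) j /\ - U <= u s j <= U)) as [e [he hnb]].
  { intros j. destruct (hint j) as [h1 h2].
    destruct (continuous_eps_inv _ _ (hdxc t j (proj1 ht)) (dx (x t) j - delta)) as [e1 [he1 hn1]]; [lra|].
    destruct (continuous_eps_inv _ _ (huc t j (proj1 ht)) (Rmin (U - u t j) (u t j + U))) as [e2 [he2 hn2]].
    { apply Rmin_pos; lra. }
    exists (Rmin e1 e2). split; [now apply Rmin_pos|]. intros s hs.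
    pose proof (Rmin_l e1 e2). pose proof (Rmin_r e1 e2).
    specialize (hn1 s ltac:(lra)). specialize (hn2 s ltac:(lra)).
    pose proof (Rmin_l (U - u t j) (u t j + U)). pose proof (Rmin_r (U - u t j) (u t j + U)).
    apply Rabs_def2 in hn1, hn2. lra. }
  exists e. split; [easy|]. intros s hs hs0 j.
  destruct (periodic_reduce J j (fl_J _ _ _ _ _ _ _ _ fl)) as [k [hk ek]].
  destruct (hper s hs0) as [p1 p2].
  rewrite (ek _ (dx_periodic J (x s) p1)), (ek _ p2).
  apply hnb; [easy|]. apply Rabs_def1; lra.
Qed.

End Motion.


(** * Uniqueness and global existence *)

Lemma has_deriv_on_subset (D D' : R -> Prop) (f : R -> R) (t l : R) :
  (forall s, D s -> D' s) -> has_deriv_on D' f t l -> has_deriv_on D f t l.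
Proof.
  intros h hd. apply (has_deriv_on_local D D' f f t l 1); auto using Rlt_0_1.
Qed.

(** Unlike in [motion], derivatives are one-sided at the ends of [D]. *)
Definition motion_on (J : nat) (m nu : Z -> R) (q : Z -> R -> R) (D : R -> Prop)
    (x u : R -> Z -> R) : Prop :=
  forall t, D t ->
    periodic_lift J (x t) /\ periodic J (u t) /\ (forall j, 0 < dx (x t) j) /\
    (forall j, has_deriv_on D (fun s => x s j) t (u t j)) /\
    (forall j, has_deriv_on D (fun s => u s j) t (accel m nu q (x t) (u t) j)).

Lemma motion_on_subset J m nu q (D D' : R -> Prop) x u :
  (forall s, D s -> D' s) -> motion_on J m nu q D' x u -> motion_on J m nu q D x u.
Proof.
  intros h hm t ht. destruct (hm t (h t ht)) as [h1 [h2 [h3 [h4 h5]]]].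
  repeat split; auto; intros j; now apply (has_deriv_on_subset D D').
Qed.

Lemma motion_motion_on J m nu q b x u :
  motion J m nu q b x u -> motion_on J m nu q (fun t => 0 <= t <= b) x u.
Proof.
  intros hm t ht. repeat split.
  - now apply (mo_x_periodic _ _ _ _ _ _ _ hm).
  - now apply (mo_u_periodic _ _ _ _ _ _ _ hm).
  - intros j. now apply (mo_dx_pos _ _ _ _ _ _ _ hm).
  - intros j. apply is_derive_has_deriv_on. now apply (mo_x _ _ _ _ _ _ _ hm).
  - intros j. apply is_derive_has_deriv_on. now apply (mo_u _ _ _ _ _ _ _ hm).
Qed.

Lemma finite_lower_bound (n : nat) (P : Z -> R -> Prop) :
  (forall j r s, P j r -> 0 < s <= r -> P j s) ->
  (forall j, exists r, 0 < r /\ P j r) ->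
  exists r, 0 < r /\ forall j, (0 <= j < Z.of_nat n)%Z -> P j r.
Proof.
  intros hmono h. induction n as [|n [r [hr IH]]]; [exists 1; split; [lra|intros; lia]|].
  destruct (h (Z.of_nat n)) as [r' [hr' h']]. exists (Rmin r r').
  pose proof (Rmin_l r r'). pose proof (Rmin_r r r').
  assert (0 < Rmin r r') by now apply Rmin_pos. split; [easy|]. intros j hj.
  destruct (Z.eq_dec j (Z.of_nat n)) as [->|hne].
  - apply (hmono _ r'); auto.
  - apply (hmono _ r); auto. apply IH; lia.
Qed.

(** By compactness a motion on a closed time interval stays in a box, where the
    truncated field agrees with the true one. *)
Lemma motion_on_in_box J m nu q b x u : (1 <= J)%nat -> 0 <= b ->
  motion_on J m nu q (fun t => 0 <= t <= b) x u ->
  exists r, 0 < r /\ forall s, 0 < s <= r -> forall t, 0 <= t <= b ->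
    in_box s (/ s) (x t) (u t).
Proof.
  intros hJ hb hm.
  destruct (finite_lower_bound J (fun j r => forall t, 0 <= t <= b ->
     r <= dx (x t) j /\ - / r <= u t j <= / r)) as [r [hr h]].
  - intros j r s h hs t ht. destruct (h t ht).
    assert (/ r <= / s) by (apply Rinv_le_contravar; lra). lra.
  - intros j.
    destruct (has_deriv_on_bounded b (fun t => 0 <= t <= b) (fun t => dx (x t) j) hb)
      as [t1 [t1' [ht1 [_ h1]]]]; [auto| |].
    { intros t ht. destruct (hm t ht) as [_ [_ [_ [hx _]]]]. eexists.
      apply has_deriv_on_minus; apply hx. }
    destruct (has_deriv_on_bounded b (fun t => 0 <= t <= b) (fun t => u t j) hb)
      as [t2 [t3 [ht2 [ht3 h2]]]]; [auto| |].
    { intros t ht. destruct (hm t ht) as [_ [_ [_ [_ hu]]]]. eexists. apply hu. }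
    set (B := 1 + Rabs (u t2 j) + Rabs (u t3 j)).
    pose proof (Rabs_pos (u t2 j)). pose proof (Rabs_pos (u t3 j)).
    destruct (hm t1 ht1) as [_ [_ [hw _]]]. specialize (hw j).
    assert (hB : 0 < / B) by (apply Rinv_0_lt_compat; unfold B; lra).
    exists (Rmin (dx (x t1) j) (/ B)). split; [now apply Rmin_pos|]. intros t ht.
    specialize (h1 t ht). specialize (h2 t ht).
    pose proof (Rmin_l (dx (x t1) j) (/ B)). pose proof (Rmin_r (dx (x t1) j) (/ B)).
    assert (hBr : B <= / Rmin (dx (x t1) j) (/ B)).
    { rewrite <- (Rinv_inv B) at 1. apply Rinv_le_contravar; [apply Rmin_pos; lra|easy]. }
    assert (a2 : - Rabs (u t2 j) <= u t2 j) by (pose proof (Rabs_maj2 (u t2 j)); lra).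
    assert (a3 : u t3 j <= Rabs (u t3 j)) by apply Rle_abs.
    assert (hB1 : Rabs (u t2 j) + Rabs (u t3 j) <= B) by (unfold B; lra). lra.
  - exists r. split; [easy|]. intros s hs t ht j.
    destruct (hm t ht) as [hx [hu _]].
    destruct (periodic_reduce J j hJ) as [k [hk ek]].
    rewrite (ek _ (dx_periodic J (x t) hx)), (ek _ hu).
    destruct (h k hk t ht). assert (/ r <= / s) by (apply Rinv_le_contravar; lra). lra.
Qed.

Section Global.

Context (J : nat) (m nu : Z -> R) (q : Z -> R -> R) (nu_min nu_max C0 P1 : R).
Context (fl : fluid J m nu q nu_min nu_max C0 P1).
Context (hq : locally_lipschitz_laws q).

Theorem motion_on_unique (b : R) (x u x' u' : R -> Z -> R) : 0 <= b ->
  motion_on J m nu q (fun t => 0 <= t <= b) x u ->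
  motion_on J m nu q (fun t => 0 <= t <= b) x' u' ->
  (forall j, x 0 j = x' 0 j /\ u 0 j = u' 0 j) ->
  forall t j, 0 <= t <= b -> x t j = x' t j /\ u t j = u' t j.
Proof.
  intros hb hm hm' h0 t j ht.
  pose proof (fl_J _ _ _ _ _ _ _ _ fl) as hJ.
  destruct (motion_on_in_box J m nu q b x u hJ hb hm) as [r [hr hbox]].
  destruct (motion_on_in_box J m nu q b x' u' hJ hb hm') as [r' [hr' hbox']].
  set (d := Rmin r r').
  assert (hd : 0 < d) by now apply Rmin_pos.
  specialize (hbox d (conj hd (Rmin_l r r'))). specialize (hbox' d (conj hd (Rmin_r r r'))).
  set (U := / d) in *. assert (hU : 0 < U) by now apply Rinv_0_lt_compat.
  destruct (tr_field_lipschitz J m nu q _ _ _ _ fl hq d U hd hU) as [L [B [hL [_ [hlip _]]]]].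
  set (D := fun s => 0 <= s <= b) in *.
  assert (heq : forall s i, 0 <= s <= b -> state (x s) (u s) i = state (x' s) (u' s) i).
  { apply (ode_unique (Z + Z) (tr_field m nu q d U) D L b (2 * U * exp (2 * 1 * b))
      (fun s => state (x s) (u s)) (fun s => state (x' s) (u' s))); auto.
    - intros s i hs. rewrite tr_field_in_box by now apply hbox.
      destruct (hm s hs) as [_ [_ [_ [h1 h2]]]]. destruct i as [i|i]; [apply h1|apply h2].
    - intros s i hs. rewrite tr_field_in_box by now apply hbox'.
      destruct (hm' s hs) as [_ [_ [_ [h1 h2]]]]. destruct i as [i|i]; [apply h1|apply h2].
    - intros [i|i]; apply h0.
    - intros s i hs.
      assert (he : 1 <= exp (2 * 1 * b)) by (pose proof (exp_ineq1_le (2 * 1 * b)); lra).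
      assert (hue : 2 * U <= 2 * U * exp (2 * 1 * b)).
      { rewrite <- (Rmult_1_r (2 * U)) at 1. apply Rmult_le_compat_l; lra. }
      assert (hud : forall s i, 0 <= s <= b -> Rabs (u s i - u' s i) <= 2 * U).
      { intros r0 i0 hr0. destruct (hbox r0 hr0 i0) as [_ h1]. destruct (hbox' r0 hr0 i0) as [_ h2].
        apply Rabs_le. lra. }
      destruct i as [i|i]; cbn [state]; [|specialize (hud s i hs); lra].
      assert (hx : Rabs ((x s i - x' s i) - (x 0 i - x' 0 i)) <= 2 * U / (2 * 1) * exp (2 * 1 * s)).
      { apply (exponential_growth D (fun r => x r i - x' r i) (fun r => u r i - u' r i)); try lra.
        - intros r0 hr0. unfold D. lra.
        - intros r0 hr0. destruct (hm r0) as [_ [_ [_ [h1 _]]]]; [unfold D; lra|].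
          destruct (hm' r0) as [_ [_ [_ [h2 _]]]]; [unfold D; lra|].
          split; [apply has_deriv_on_minus; [apply h1|apply h2]|].
          eapply Rle_trans; [apply hud; lra|]. rewrite <- (Rmult_1_r (2 * U)) at 1.
          apply Rmult_le_compat_l; [lra|]. pose proof (exp_ineq1_le (2 * 1 * r0)). lra. }
      rewrite (proj1 (h0 i)), Rminus_diag, Rminus_0_r in hx.
      eapply Rle_trans; [exact hx|]. pose proof (exp_pos (2 * 1 * s)).
      apply Rmult_le_compat; [|lra|lra|].
      + apply Rdiv_le_0_compat; lra.
      + destruct (Req_dec s b) as [->|]; [lra|]. left. apply exp_increasing. lra. }
  split; [apply (heq t (inl j) ht)|apply (heq t (inr j) ht)].
Qed.

(** Motions on [[0, n]] agree where they are both defined; the global motion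
    takes at time [t] the value of any of them with [t <= n]. *)
Theorem global_motion (X V : Z -> R) :
  periodic_lift J X -> periodic J V -> (forall j, 0 < dx X j) ->
  exists x u, (forall j, x 0 j = X j /\ u 0 j = V j) /\
    motion_on J m nu q (fun t => 0 <= t) x u /\
    forall b, 0 <= b -> exists y v, motion J m nu q b y v /\
      forall t j, 0 <= t <= b -> x t j = y t j /\ u t j = v t j.
Proof.
  intros hX hV hw.
  assert (hex : forall n, exists xu : (R -> Z -> R) * (R -> Z -> R),
    motion J m nu q (INR n) (fst xu) (snd xu) /\
    (forall j, fst xu 0 j = X j) /\ (forall j, snd xu 0 j = V j)).
  { intros n. destruct (motion_exists J m nu q _ _ _ _ fl hq X V (INR n) (pos_INR n) hX hV hw)
      as [x [u h]]. now exists (x, u). }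
  set (sol := fun n => proj1_sig (constructive_indefinite_description _ (hex n))).
  assert (hsol : forall n, motion J m nu q (INR n) (fst (sol n)) (snd (sol n)) /\
    (forall j, fst (sol n) 0 j = X j) /\ (forall j, snd (sol n) 0 j = V j)).
  { intros n. exact (proj2_sig (constructive_indefinite_description _ (hex n))). }
  clearbody sol.
  assert (hagree : forall n k t j, 0 <= t -> t <= INR n -> t <= INR k ->
    fst (sol n) t j = fst (sol k) t j /\ snd (sol n) t j = snd (sol k) t j).
  { intros n k t j h0 hn hk. destruct (hsol n) as [m1 [x1 v1]]. destruct (hsol k) as [m2 [x2 v2]].
    apply motion_motion_on in m1, m2.
    apply (motion_on_unique t); [easy| | | |lra].
    - apply (motion_on_subset _ _ _ _ _ (fun t => 0 <= t <= INR n)); [|easy]. intros; lra.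
    - apply (motion_on_subset _ _ _ _ _ (fun t => 0 <= t <= INR k)); [|easy]. intros; lra.
    - intros i. now rewrite x1, x2, v1, v2. }
  set (N := fun t => Z.to_nat (up t)).
  assert (hN : forall t, 0 <= t -> t <= INR (N t)).
  { intros t ht. destruct (archimed t) as [h1 _]. unfold N. rewrite INR_IZR_INZ, Z2Nat.id; [lra|].
    apply le_IZR. lra. }
  set (x := fun t j => fst (sol (N t)) t j). set (u := fun t j => snd (sol (N t)) t j).
  assert (hxu : forall n t j, 0 <= t <= INR n -> x t j = fst (sol n) t j /\ u t j = snd (sol n) t j).
  { intros n t j [h1 h2]. apply hagree; auto. }
  exists x, u. split; [|split].
  - intros j. destruct (hsol (N 0)) as [_ [h1 h2]]. split; [apply h1|apply h2].
  - intros t ht. set (n := S (N t)).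
    assert (hn : t + 1 <= INR n) by (unfold n; rewrite S_INR; specialize (hN t ht); lra).
    destruct (motion_motion_on _ _ _ _ _ _ _ (proj1 (hsol n)) t ltac:(lra)) as [p1 [p2 [p3 [p4 p5]]]].
    assert (ex : forall j, x t j = fst (sol n) t j) by (intros j; apply hxu; lra).
    assert (eu : forall j, u t j = snd (sol n) t j) by (intros j; apply hxu; lra).
    assert (ea : forall j, accel m nu q (x t) (u t) j = accel m nu q (fst (sol n) t) (snd (sol n) t) j).
    { intros j. unfold accel, stress, Du, dx. now rewrite !ex, !eu. }
    split; [|split; [|split; [|split]]].
    + intros j. rewrite !ex. apply p1.
    + intros j. rewrite !eu. apply p2.
    + intros j. unfold dx. rewrite !ex. apply p3.
    + intros j. rewrite eu.
      apply (has_deriv_on_local _ (fun s => 0 <= s <= INR n) _ (fun s => fst (sol n) s j) _ _ 1);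
        [lra| |apply ex|apply p4].
      intros s hs hst. apply Rabs_def2 in hst. split; [lra|]. apply hxu; lra.
    + intros j. rewrite ea.
      apply (has_deriv_on_local _ (fun s => 0 <= s <= INR n) _ (fun s => snd (sol n) s j) _ _ 1);
        [lra| |apply eu|apply p5].
      intros s hs hst. apply Rabs_def2 in hst. split; [lra|]. apply hxu; lra.
  - intros b hb. exists (fst (sol (N b))), (snd (sol (N b))).
    destruct (hsol (N b)) as [hm _]. specialize (hN b hb). split.
    + destruct hm as [h1 h2 h3 h4 h5].
      split; intros; [apply h1|apply h2|apply h3|apply h4|apply h5]; lra.
    + intros t j ht. apply hxu; lra.
Qed.

End Global.


(** * Constants attached to the constitutive laws *)

Lemma pressure_derivative (I : R -> Prop) (p : R -> R -> R) :
  smooth2_on (fun rho => 0 <= rho) I p ->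
  exists p0 p1 : R -> R -> R,
    (forall r c, 0 <= r -> I c -> p0 r c = p r c) /\
    continuous_on (fun z : R * R => 0 <= fst z /\ I (snd z)) (fun z => p0 (fst z) (snd z)) /\
    continuous_on (fun z : R * R => 0 <= fst z /\ I (snd z)) (fun z => p1 (fst z) (snd z)) /\
    forall r c, 0 < r -> I c -> is_derive (fun r => p r c) r (p1 r c).
Proof.
  intros [F [hF0 [hFc hFd]]]. exists (F 0%nat 0%nat), (F 1%nat 0%nat).
  split; [exact hF0|split; [apply hFc|split; [apply hFc|]]].
  intros r c hr hc.
  assert (hloc : locally r (fun s => 0 <= s)).
  { exists (mkposreal r hr). intros s hs. change (Rabs (s - r) < r) in hs.
    apply Rabs_def2 in hs. lra. }
  apply (is_derive_ext_loc (fun s => F 0%nat 0%nat s c)).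
  - revert hloc. apply filter_imp. intros s hs. now apply hF0.
  - apply (has_deriv_on_is_derive (fun s => 0 <= s)); [easy|].
    apply (hFd 0%nat 0%nat r c); [lra|easy].
Qed.

Lemma lipschitz_of_derive (f f' : R -> R) (b L : R) :
  (forall r, 0 < r <= b -> is_derive f r (f' r) /\ Rabs (f' r) <= L) ->
  forall r s, 0 < r <= b -> 0 < s <= b -> Rabs (f r - f s) <= L * Rabs (r - s).
Proof.
  intros h r s hr hs.
  assert (hmm : forall c, Rmin s r <= c <= Rmax s r -> 0 < c <= b).
  { intros c [h1 h2]. split.
    - eapply Rlt_le_trans; [|exact h1]. apply Rmin_pos; lra.
    - eapply Rle_trans; [exact h2|]. apply Rmax_lub; lra. }
  destruct (MVT_gen f s r f') as [c [hc e]].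
  - intros t ht. apply h, hmm. lra.
  - intros t ht. apply continuity_pt_filterlim. eapply is_derive_continuous.
    apply h, hmm. lra.
  - rewrite e, Rabs_mult. apply Rmult_le_compat_r; [apply Rabs_pos|]. apply h, hmm. lra.
Qed.

Lemma pressure_bounds (I : R -> Prop) (p : R -> R -> R) (mu : R -> R) (a b r0 : R) :
  constitutive_laws I p mu -> I a -> I b -> 0 < r0 ->
  exists Q L, 0 <= Q /\ 0 <= L /\ forall c r s, a <= c <= b -> 0 < r <= r0 -> 0 < s <= r0 ->
    Rabs (p r c) <= Q /\ Rabs (p r c - p s c) <= L * Rabs (r - s).
Proof.
  intros hl ha hb hr0.
  destruct (pressure_derivative I p (laws_p_smooth _ _ _ hl)) as [p0 [p1 [e0 [h0 [h1 hd]]]]].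
  assert (hI : forall c, a <= c <= b -> I c).
  { intros c hc. apply (laws_interval _ _ _ hl a b); auto. }
  assert (h00 : forall x, 0 <= x <= r0 -> 0 <= x) by (intros; lra).
  destruct (continuous_on_rectangle_bounded _ I p0 0 r0 a b h00 hI h0) as [Q [hQ0 hQ]].
  destruct (continuous_on_rectangle_bounded _ I p1 0 r0 a b h00 hI h1) as [L [hL0 hL]].
  exists Q, L. split; [easy|split; [easy|]]. intros c r s hc hr hs. split.
  - rewrite <- e0 by (auto; lra). apply hQ; lra.
  - apply (lipschitz_of_derive (fun r => p r c) (fun r => p1 r c) r0); auto.
    intros y hy. split; [apply hd; [lra|auto]|apply hL; lra].
Qed.

Lemma viscosity_bounded (I : R -> Prop) (mu : R -> R) (a b : R) :
  smooth1_on I mu -> (forall c, a <= c <= b -> I c) ->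
  exists M, forall c, a <= c <= b -> mu c <= M.
Proof.
  intros [F [hF0 [hFc _]]] hI.
  destruct (continuous_on_rectangle_bounded (fun _ => True) I (fun _ c => F 0%nat c) 0 0 a b)
    as [M [_ hM]]; auto.
  - intros [x y] [_ hy] P hP. destruct (hFc 0%nat y hy P hP) as [e he]. exists e.
    intros [x' y'] [_ hb] [_ hy']. now apply he.
  - exists M. intros c hc. rewrite <- hF0 by auto.
    eapply Rle_trans; [apply Rle_abs|]. apply (hM 0 c); lra.
Qed.

Record law_constants (I : R -> Prop) (p : R -> R -> R) (mu : R -> R)
    (c_min c_max nu_min nu_max C0 P1 : R) : Prop := {
  lc_I : forall c, c_min <= c <= c_max -> I c;
  lc_nu_min : 0 < nu_min;
  lc_nu : forall c, c_min <= c <= c_max -> nu_min <= mu c <= nu_max;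
  lc_C0 : 0 < C0;
  lc_energy : forall rho c, 0 < rho -> c_min <= c <= c_max -> p rho c <= C0 * (rho + H p rho c);
  lc_P1 : 0 <= P1;
  lc_small : forall rho c, 0 < rho <= 1 -> c_min <= c <= c_max -> p rho c <= P1
}.

Lemma law_constants_exist (I : R -> Prop) (p : R -> R -> R) (mu : R -> R) (c_min c_max : R) :
  constitutive_laws I p mu -> I c_min -> I c_max ->
  exists nu_min nu_max C0 P1, law_constants I p mu c_min c_max nu_min nu_max C0 P1.
Proof.
  intros hl h1 h2.
  assert (hI : forall c, c_min <= c <= c_max -> I c).
  { intros c hc. apply (laws_interval _ _ _ hl c_min c_max); auto. }
  destruct (laws_mu_lower _ _ _ hl) as [nu_min [hnm hn]].
  destruct (viscosity_bounded I mu c_min c_max (laws_mu_smooth _ _ _ hl) hI) as [nu_max hx].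
  destruct (laws_p_energy _ _ _ hl) as [C0 [hC hE]].
  destruct (pressure_bounds I p mu c_min c_max 1 hl h1 h2 Rlt_0_1) as [P1 [L [hP [_ hb]]]].
  exists nu_min, nu_max, C0, P1. split; auto.
  intros rho c hr hc. eapply Rle_trans; [apply Rle_abs|]. now apply (hb c rho rho).
Qed.

(** * Reduction of the system *)

Definition cell_mass (x0 rho0 : Z -> R) (j : Z) : R := rho0 j * dx x0 j.

Section Reduction.

Context (I : R -> Prop) (p : R -> R -> R) (mu : R -> R) (hl : constitutive_laws I p mu).
Context (J : nat) (x0 c0 rho0 u0 : Z -> R).
Context (hJ : (1 <= J)%nat) (hini : initial_data J x0 c0 rho0 u0).

Let m := cell_mass x0 rho0.
Let nu (j : Z) := mu (c0 j).
Let q (j : Z) (r : R) := p r (c0 j).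

Lemma initial_dx_pos (j : Z) : 0 < dx x0 j.
Proof. apply (dx_pos J); auto; apply hini. Qed.

Lemma initial_rho_pos (j : Z) : 0 < rho0 j.
Proof.
  eapply Rlt_le_trans; [apply (init_rho_pos _ _ _ _ _ hini)|].
  apply minJ_le; auto. apply hini.
Qed.

Lemma cell_mass_pos (j : Z) : 0 < m j.
Proof. apply Rmult_lt_0_compat; [apply initial_rho_pos|apply initial_dx_pos]. Qed.

Lemma fluid_of_data (c_min c_max nu_min nu_max C0 P1 : R) :
  law_constants I p mu c_min c_max nu_min nu_max C0 P1 ->
  (forall j, c_min <= c0 j <= c_max) -> fluid J m nu q nu_min nu_max C0 P1.
Proof.
  intros hc hcj.
  destruct (pressure_derivative I p (laws_p_smooth _ _ _ hl)) as [p0 [p1 [e0 [h0 [h1 hd]]]]].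
  split.
  - exact hJ.
  - intros j. unfold m, cell_mass.
    rewrite (init_rho _ _ _ _ _ hini), (dx_periodic J x0 (init_x _ _ _ _ _ hini)). reflexivity.
  - intros j. unfold nu. now rewrite (init_c _ _ _ _ _ hini).
  - intros r j. unfold q. now rewrite (init_c _ _ _ _ _ hini).
  - exact cell_mass_pos.
  - apply hc.
  - intros j. now apply hc.
  - intros j r hr. apply (is_derive_continuous _ _ (p1 r (c0 j))). apply hd; [easy|now apply hc].
  - intros j r hr. apply (laws_p_nonneg _ _ _ hl); [lra|now apply hc].
  - apply hc.
  - intros j r hr. now apply (lc_energy _ _ _ _ _ _ _ _ _ hc).
  - apply hc.
  - intros j r hr. now apply hc.
Qed.

Lemma locally_lipschitz_of_data (c_min c_max : R) :
  I c_min -> I c_max -> (forall j, c_min <= c0 j <= c_max) -> locally_lipschitz_laws q.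
Proof.
  intros h1 h2 hcj b hb.
  destruct (pressure_bounds I p mu c_min c_max b hl h1 h2 hb) as [Q [L [hQ [hL h]]]].
  exists Q, L. split; [easy|split; [easy|]]. intros j r s hr hs. now apply h.
Qed.

Lemma interface_mass (X rho : Z -> R) (j : Z) :
  (forall k, 0 < dx X k) -> (forall k, rho k = m k / dx X k) ->
  rhoh X rho j * dxh X j = mass_h m j.
Proof.
  intros hw hr. unfold rhoh, dxh, mass_h. rewrite !hr.
  pose proof (hw j). pose proof (hw (j + 1)%Z). field. repeat split; lra.
Qed.

Lemma time_dom_initial (T : Rbar) (t s : R) : time_dom T t -> 0 <= s <= t -> time_dom T s.
Proof.
  intros [h1 h2] hs. split; [lra|]. destruct T as [T| |]; simpl in *; auto. lra.
Qed.

Lemma solution_motion (T : Rbar) (x c rho u : R -> Z -> R) :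
  is_solution p mu J x0 c0 rho0 u0 T x c rho u ->
  (forall t j, time_dom T t -> c t j = c0 j /\ rho t j = m j / dx (x t) j) /\
  motion_on J m nu q (time_dom T) x u.
Proof.
  intros hs.
  assert (hw : forall t j, time_dom T t -> 0 < dx (x t) j).
  { intros t j ht.
    apply (dx_pos J); auto; [now apply hs|now apply (sol_ordered _ _ _ _ _ _ _ _ _ _ _ _ hs)]. }
  assert (hcr : forall t j, time_dom T t -> c t j = c0 j /\ rho t j = m j / dx (x t) j).
  { intros t j ht. destruct (sol_init _ _ _ _ _ _ _ _ _ _ _ _ hs j) as [_ [e1 _]].
    split.
    - rewrite <- e1.
      apply (constant_of_has_deriv_on (time_dom T) (fun s => c s j)); [apply ht| |].
      + intros s h. now apply (time_dom_initial T t).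
      + intros s h. apply (sol_c _ _ _ _ _ _ _ _ _ _ _ _ hs). now apply (time_dom_initial T t).
    - assert (e : rho t j * dx (x t) j = rho 0 j * dx (x 0) j).
      { apply (constant_of_has_deriv_on (time_dom T) (fun s => rho s j * dx (x s) j)); [apply ht| |].
        - intros s h. now apply (time_dom_initial T t).
        - intros s h. apply (sol_mass _ _ _ _ _ _ _ _ _ _ _ _ hs).
          now apply (time_dom_initial T t). }
      unfold m, cell_mass. unfold dx at 1.
      destruct (sol_init _ _ _ _ _ _ _ _ _ _ _ _ hs j) as [<- [_ [<- _]]].
      destruct (sol_init _ _ _ _ _ _ _ _ _ _ _ _ hs (j - 1)%Z) as [<- _].
      fold (dx (x 0) j). rewrite <- e. field. specialize (hw t j ht). lra. }
  split; [exact hcr|]. intros t ht.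
  destruct (sol_periodic _ _ _ _ _ _ _ _ _ _ _ _ hs t ht) as [hx [_ [_ hu]]].
  split; [easy|split; [easy|split; [intros j; now apply hw|split]]].
  - intros j. now apply (sol_x _ _ _ _ _ _ _ _ _ _ _ _ hs).
  - intros j. destruct (sol_momentum _ _ _ _ _ _ _ _ _ _ _ _ hs t j ht) as [du [hd e]].
    replace (accel m nu q (x t) (u t) j) with du; [easy|].
    rewrite (interface_mass (x t) (rho t) j) in e;
      [|intros k; now apply hw|intros k; now apply hcr].
    destruct (hcr t j ht) as [c1 r1]. destruct (hcr t (j + 1)%Z ht) as [c2 r2].
    rewrite c1, c2, r1, r2 in e. unfold accel, stress.
    assert (hmh : 0 < mass_h m j).
    { unfold mass_h. pose proof (cell_mass_pos j). pose proof (cell_mass_pos (j + 1)%Z). lra. }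
    apply Rmult_eq_reg_l with (mass_h m j); [|lra].
    match goal with |- _ = ?n * (?d / ?n) => replace (n * (d / n)) with d by (field; lra) end.
    unfold nu, q. lra.
Qed.

Lemma motion_solution (x u : R -> Z -> R) :
  (forall j, x 0 j = x0 j /\ u 0 j = u0 j) -> motion_on J m nu q (fun t => 0 <= t) x u ->
  is_solution p mu J x0 c0 rho0 u0 p_infty x (fun _ => c0)
    (fun t j => m j / dx (x t) j) u.
Proof.
  intros h0 hm.
  assert (hdom : forall f t l, has_deriv_on (fun t => 0 <= t) f t l ->
    has_deriv_on (time_dom p_infty) f t l).
  { intros f t l. apply has_deriv_on_subset. now intros s [hs _]. }
  assert (hcst : forall a t, has_deriv_on (time_dom p_infty) (fun _ => a) t 0).
  { intros a t. apply is_derive_has_deriv_on, is_derive_Rconst. }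
  split.
  - intros j. destruct (h0 j) as [e1 e2]. repeat split; auto.
    assert (ed : dx (x 0) j = dx x0 j).
    { unfold dx. rewrite e1. f_equal. f_equal. apply h0. }
    rewrite ed. unfold m, cell_mass. field. pose proof (initial_dx_pos j). lra.
  - intros t [ht _]. destruct (hm t ht) as [h1 [h2 _]].
    split; [easy|split; [apply hini|split; [|easy]]].
    intros j. rewrite (dx_periodic J (x t) h1). f_equal. unfold m, cell_mass.
    rewrite (init_rho _ _ _ _ _ hini), (dx_periodic J x0 (init_x _ _ _ _ _ hini)). reflexivity.
  - intros t [ht _] j _. destruct (hm t ht) as [_ [_ [h3 _]]].
    specialize (h3 j). unfold dx in h3. lra.
  - intros t j [ht _]. now apply hdom, hm.
  - intros t j _. apply hcst.
  - intros t j [ht htT].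
    assert (hcm : forall s, 0 <= s -> m j / dx (x s) j * dx (x s) j = m j).
    { intros s hs. destruct (hm s hs) as [_ [_ [h3 _]]]. field. specialize (h3 j). lra. }
    apply (has_deriv_on_local _ (time_dom p_infty) _ (fun _ => m j) t 0 1);
      [lra| |now apply hcm|apply hcst].
    intros s hs _. split; [easy|]. apply hcm, hs.
  - intros t j [ht _]. destruct (hm t ht) as [_ [_ [h3 [_ h5]]]].
    exists (accel m nu q (x t) (u t) j). split; [now apply hdom|].
    rewrite (interface_mass (x t)); auto. unfold accel, stress, nu, q.
    field. unfold mass_h. pose proof (cell_mass_pos j). pose proof (cell_mass_pos (j + 1)%Z). lra.
Qed.

Lemma mass_of_motion (x : R -> Z -> R) (t : R) :
  (forall j, 0 < dx (x t) j) -> mass J x (fun t j => m j / dx (x t) j) t = sumn J m.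
Proof.
  intros hw. unfold mass. rewrite sumJ_sumn by easy. apply sumn_ext. intros j _.
  field. specialize (hw j). lra.
Qed.

Lemma continuous_dissipation (b : R) (y v : R -> Z -> R) (t : R) :
  motion J m nu q b y v -> 0 <= t <= b ->
  continuous (fun s => dissipation J nu (y s) (v s)) t.
Proof.
  intros hm ht.
  apply (continuous_sumn J (fun s j => nu j * Du (y s) (v s) j ^ 2 * dx (y s) j)). intros j _.
  pose proof (mo_dx_pos _ _ _ _ _ _ _ hm t j ht) as hw.
  pose proof (is_derive_dx y v t j (fun k => mo_x _ _ _ _ _ _ _ hm t k ht)) as hd.
  eapply is_derive_continuous.
  apply (is_derive_ext (fun s => nu j * ((v s j - v s (j - 1)%Z) * (1 / dx (y s) j) *
    ((v s j - v s (j - 1)%Z) * (1 / dx (y s) j))) * dx (y s) j)).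
  { intros s. unfold Du, Rdiv. simpl. ring. }
  assert (hD : is_derive (fun s => (v s j - v s (j - 1)%Z) * (1 / dx (y s) j)) t
    ((accel m nu q (y t) (v t) j - accel m nu q (y t) (v t) (j - 1)%Z) * (1 / dx (y t) j)
     + (v t j - v t (j - 1)%Z) * (- (1 / dx (y t) j) * ((v t j - v t (j - 1)%Z) / dx (y t) j)))).
  { apply (is_derive_Rmult (fun s => v s j - v s (j - 1)%Z) (fun s => 1 / dx (y s) j));
      [apply is_derive_Rminus; now apply (mo_u _ _ _ _ _ _ _ hm)|].
    now apply (is_derive_density 1 (fun s => dx (y s) j)). }
  apply is_derive_Rmult; [|exact hd]. apply is_derive_Rscal. apply is_derive_Rmult; exact hD.
Qed.

(** The dissipation is the derivative of minus the energy, so its integral is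
    exactly the energy that was lost. *)
Lemma energy_of_motion (nu_min nu_max C0 P1 t : R) (x u y v : R -> Z -> R) :
  fluid J m nu q nu_min nu_max C0 P1 -> 0 <= t -> motion J m nu q t y v ->
  (forall s j, 0 <= s <= t -> x s j = y s j /\ u s j = v s j) ->
  energy p mu J x (fun _ => c0) (fun t j => m j / dx (x t) j) u t =
  kinetic J m (v 0) + potential J m q (y 0).
Proof.
  intros fl ht hm he.
  assert (hdx : forall s j, 0 <= s <= t -> dx (x s) j = dx (y s) j).
  { intros s j hs. unfold dx. destruct (he s j hs) as [-> _].
    now destruct (he s (j - 1)%Z hs) as [-> _]. }
  assert (hint : RInt (fun s => dissipation J nu (y s) (v s)) 0 t =
    (kinetic J m (v 0) + potential J m q (y 0)) - (kinetic J m (v t) + potential J m q (y t))).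
  { apply is_RInt_unique.
    set (en := fun s => kinetic J m (v s) + potential J m q (y s)).
    replace (kinetic J m (v 0) + potential J m q (y 0) - (kinetic J m (v t) + potential J m q (y t)))
      with (minus (- en t) (- en 0)) by (unfold minus, plus, opp, en; simpl; ring).
    apply (is_RInt_derive (fun s => - en s) (fun s => dissipation J nu (y s) (v s))).
    - intros s. rewrite Rmin_left, Rmax_right by easy. intros hs.
      apply (is_derive_eq _ _ (- - dissipation J nu (y s) (v s))); [|apply Ropp_involutive].
      apply (is_derive_opp en s). now apply (is_derive_energy J m nu q _ _ _ _ fl t).
    - intros s. rewrite Rmin_left, Rmax_right by easy. intros hs.
      now apply (continuous_dissipation t). }
  unfold energy. rewrite !sumJ_sumn by easy.
  assert (hk : / 2 * sumn J (fun j =>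
      rhoh (x t) (fun j => m j / dx (x t) j) j * u t j ^ 2 * dxh (x t) j) = kinetic J m (v t)).
  { unfold kinetic. f_equal. apply sumn_ext. intros j _.
    rewrite <- (interface_mass (x t) (fun j => m j / dx (x t) j) j); auto.
    - destruct (he t j) as [_ ->]; [lra|]. ring.
    - intros k. rewrite hdx by lra. apply (mo_dx_pos _ _ _ _ _ _ _ hm); lra. }
  assert (hp : sumn J (fun j => H p (m j / dx (x t) j) (c0 j) * dx (x t) j) = potential J m q (y t)).
  { unfold potential. apply sumn_ext. intros j _. rewrite !hdx by lra.
    unfold H, specific_energy, q. field.
    apply Rgt_not_eq, (mo_dx_pos _ _ _ _ _ _ _ hm); lra. }
  rewrite hk, hp.
  rewrite (RInt_ext _ (fun s => dissipation J nu (y s) (v s))).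
  - rewrite hint. ring.
  - intros s. rewrite Rmin_left, Rmax_right by easy. intros hs.
    rewrite sumJ_sumn by easy. unfold dissipation. apply sumn_ext. intros j _.
    unfold Du, nu. rewrite !hdx by lra. destruct (he s j) as [_ ->]; [lra|].
    now destruct (he s (j - 1)%Z) as [_ ->]; [lra|].
Qed.

End Reduction.


(** * Bounds in terms of the initial data *)

Definition initial_energy_bound (rho_max Q h1 : R) : R :=
  rho_max * (1 + (2 + h1) ^ 2 / 2 + rho_max * Q).

(** The discrete Sobolev embedding: a velocity is compared with all the others
    along the torus, and these are averaged with the weights [dx].  The kinetic
    energy cannot be read off the first sum of [discrete_H1] directly, as its
    weights involve both neighbouring cells of an interface. *)
Lemma velocity_le_discrete_H1 (J : nat) (X V : Z -> R) (j : Z) : (1 <= J)%nat ->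
  periodic_lift J X -> (forall j, 0 < dx X j) -> (0 <= j < Z.of_nat J)%Z ->
  Rabs (V j) <= 2 + discrete_H1 J X V.
Proof.
  intros hJ hX hw hj. unfold discrete_H1. rewrite !sumJ_sumn by easy.
  set (a := sumn J (fun j => V j ^ 2 * dx X j)).
  set (b := sumn J (fun j => Du X V j ^ 2 * dx X j)).
  pose proof (velocity_variation_le J X V hX hw) as hvar. fold b in hvar.
  set (S := sumn J (fun i => Rabs (V i - V (i - 1)%Z))) in *.
  assert (hfrom : forall i, (0 <= i < Z.of_nat J)%Z -> Rabs (V i - V (-1)%Z) <= S).
  { intros i hi.
    pose proof (sumn_telescope (Datatypes.S (Z.to_nat i)) (fun k => V (k - 1)%Z)) as ht.
    cbv beta in ht. replace (Z.of_nat (Datatypes.S (Z.to_nat i)) - 1)%Z with i in ht by lia.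
    change (0 - 1)%Z with (-1)%Z in ht. rewrite <- ht.
    eapply Rle_trans; [apply sumn_Rabs|].
    rewrite (sumn_ext _ _ (fun k => Rabs (V k - V (k - 1)%Z))).
    - apply sumn_mono; [lia|]. intros; apply Rabs_pos.
    - intros k _. now replace (k + 1 - 1)%Z with k by lia. }
  assert (hmean : Rabs (V j) - 2 * S <= / 2 * (1 + a)).
  { replace (Rabs (V j) - 2 * S) with ((Rabs (V j) - 2 * S) * sumn J (dx X))
      by (rewrite (sumn_dx J X hX); ring).
    rewrite <- (sumn_dx J X hX). unfold a.
    rewrite <- sumn_plus, <- !sumn_scal. apply sumn_le. intros i hi.
    replace (/ 2 * (dx X i + V i ^ 2 * dx X i)) with (/ 2 * (1 + V i ^ 2) * dx X i) by ring.
    apply Rmult_le_compat_r; [left; apply hw|].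
    pose proof (Rabs_le_half_square (V i)). pose proof (hfrom i hi) as h1.
    pose proof (hfrom j hj) as h2.
    enough (Rabs (V j) <= Rabs (V i) + Rabs (V i - V (-1)%Z) + Rabs (V j - V (-1)%Z)) by lra.
    unfold Rabs; repeat destruct Rcase_abs; lra. }
  assert (0 <= a).
  { apply sumn_nonneg. intros i _. apply Rmult_le_pos; [apply pow2_ge_0|left; apply hw]. }
  lra.
Qed.

Section InitialEnergy.

Context (J : nat) (m nu : Z -> R) (q : Z -> R -> R) (nu_min nu_max C0 P1 : R).
Context (fl : fluid J m nu q nu_min nu_max C0 P1).

Lemma specific_energy_le (j : Z) (r r0 Q : R) :
  0 < r <= r0 -> 0 <= Q -> (forall s, 0 < s <= r0 -> q j s <= Q) ->
  specific_energy q j r <= r0 * Q.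
Proof.
  intros hr hQ hb.
  pose proof (is_derive_specific_energy J m nu q _ _ _ _ fl j) as hd.
  assert (h1 : specific_energy q j 1 = 0) by (unfold specific_energy; now rewrite (RInt_point 1)).
  assert (hq0 : forall s, 0 < s -> 0 <= q j s / s ^ 2).
  { intros s hs. apply Rdiv_le_0_compat; [now apply (fl_q_nonneg _ _ _ _ _ _ _ _ fl)|now apply pow_lt]. }
  assert (hrQ : 0 <= r0 * Q) by (apply Rmult_le_pos; lra).
  destruct (Rle_lt_dec r 1) as [hle|hgt].
  - enough (specific_energy q j r <= specific_energy q j 1) by lra.
    apply (nondecreasing_of_is_derive _ (fun s => q j s / s ^ 2)); [easy| |].
    + intros s hs. apply hd; lra.
    + intros s hs. apply hq0; lra.
  - enough (specific_energy q j r - Q * r <= specific_energy q j 1 - Q * 1).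
    { assert (Q * r <= r0 * Q) by (rewrite (Rmult_comm r0); apply Rmult_le_compat_l; lra). lra. }
    assert (hder : forall s, 0 < s ->
      is_derive (fun s => specific_energy q j s - Q * s) s (q j s / s ^ 2 - Q * 1)).
    { intros s hs. apply is_derive_Rminus; [now apply hd|]. apply is_derive_Rscal, is_derive_Rid. }
    apply (nonincreasing_of_derive (fun s => specific_energy q j s - Q * s)
      (fun s => q j s / s ^ 2 - Q * 1)); [lra| |].
    + intros s hs. split; [apply hder; lra|].
      enough (q j s / s ^ 2 <= Q) by lra.
      apply Rle_trans with (q j s); [|apply hb; lra].
      assert (0 <= q j s) by (apply (fl_q_nonneg _ _ _ _ _ _ _ _ fl); lra).
      assert (1 <= s ^ 2) by (simpl; nra).
      apply Rmult_le_reg_r with (s ^ 2); [lra|].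
      unfold Rdiv. rewrite Rmult_assoc, Rinv_l, Rmult_1_r by lra. nra.
    + intros s hs. eapply is_derive_continuous. apply hder. lra.
Qed.

Lemma initial_energy_le (X V : Z -> R) (rho_max Q h1 : R) :
  periodic_lift J X -> (forall j, 0 < dx X j) -> 0 < rho_max -> 0 <= Q -> 0 <= h1 ->
  (forall j, m j / dx X j <= rho_max) ->
  (forall j s, 0 < s <= rho_max -> q j s <= Q) ->
  discrete_H1 J X V = h1 ->
  kinetic J m V + potential J m q X + sumn J m <= initial_energy_bound rho_max Q h1 /\
  sumn J m <= initial_energy_bound rho_max Q h1.
Proof.
  intros hX hw hr hQ hh hrho hq hH.
  pose proof (fl_m_pos _ _ _ _ _ _ _ _ fl) as hm.
  assert (hM : sumn J m <= rho_max).
  { rewrite <- (Rmult_1_r rho_max), <- (sumn_dx J X hX), <- sumn_scal. apply sumn_le.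
    intros j _. specialize (hrho j). specialize (hw j).
    apply Rmult_le_reg_r with (/ dx X j); [now apply Rinv_0_lt_compat|].
    rewrite Rmult_assoc, Rinv_r, Rmult_1_r by lra. exact hrho. }
  assert (hM0 : 0 <= sumn J m) by (apply sumn_nonneg; intros j _; left; apply hm).
  assert (hk : kinetic J m V <= (2 + h1) ^ 2 / 2 * sumn J m).
  { unfold kinetic. rewrite <- (sumn_mass_h J m nu q _ _ _ _ fl), <- !sumn_scal.
    apply sumn_le. intros j hj.
    pose proof (velocity_le_discrete_H1 J X V j (fl_J _ _ _ _ _ _ _ _ fl) hX hw hj) as hv.
    rewrite hH in hv. pose proof (mass_h_pos J m nu q _ _ _ _ fl j) as hmh.
    assert (hsq : V j ^ 2 <= (2 + h1) ^ 2).
    { rewrite <- (pow2_abs (V j)). apply pow_incr. split; [apply Rabs_pos|easy]. }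
    replace ((2 + h1) ^ 2 / 2 * mass_h m j) with (/ 2 * (mass_h m j * (2 + h1) ^ 2)) by field.
    apply Rmult_le_compat_l; [lra|]. apply Rmult_le_compat_l; lra. }
  assert (hp : potential J m q X <= rho_max * Q * sumn J m).
  { unfold potential. rewrite <- sumn_scal. apply sumn_le. intros j _.
    rewrite (Rmult_comm (rho_max * Q)). apply Rmult_le_compat_l; [left; apply hm|].
    apply specific_energy_le; auto. split; [|apply hrho]. apply Rdiv_lt_0_compat; auto. }
  assert (h2 : 0 <= (2 + h1) ^ 2 / 2).
  { pose proof (pow2_ge_0 (2 + h1)). lra. }
  assert (h3 : 0 <= rho_max * Q) by (apply Rmult_le_pos; lra).
  set (g := 1 + (2 + h1) ^ 2 / 2 + rho_max * Q).
  assert (hg : sumn J m * g <= rho_max * g) by (apply Rmult_le_compat_r; unfold g; lra).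
  assert (hg1 : sumn J m * 1 <= sumn J m * g) by (apply Rmult_le_compat_l; unfold g; lra).
  unfold initial_energy_bound. fold g. split; [|lra].
  apply Rle_trans with (sumn J m * g); [unfold g; lra|easy].
Qed.

End InitialEnergy.

Lemma control_function_exp (k a b : R) :
  0 < k -> 0 < b -> control_function (fun t => k * exp (a + b * t)).
Proof.
  intros hk hb. split; [|split].
  - intros t _. apply Rmult_lt_0_compat; [easy|apply exp_pos].
  - intros s t _ hst. apply Rmult_lt_compat_l; [easy|]. apply exp_increasing.
    assert (b * s < b * t) by now apply Rmult_lt_compat_l. lra.
  - intros t _. eapply filterlim_filter_le_1; [apply filter_le_within|].
    apply (ex_derive_continuous (fun t => k * exp (a + b * t))). auto_derive. easy.
Qed.

Lemma exp_bounds_of_log (r A : R) : 0 < r -> Rabs (ln r) <= A -> / exp A <= r <= exp A.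
Proof.
  intros hr h. apply Rabs_le_between in h.
  assert (hmono : forall y z, y <= z -> exp y <= exp z).
  { intros y z [hlt| ->]; [left; now apply exp_increasing|lra]. }
  pose proof (hmono (- A) (ln r) (proj1 h)) as h1. pose proof (hmono (ln r) A (proj2 h)) as h2.
  rewrite exp_Ropp, exp_ln in h1 by easy. rewrite exp_ln in h2 by easy. lra.
Qed.

Lemma ln_bounded (r a b : R) : 0 < a -> a <= r <= b -> Rabs (ln r) <= Rabs (ln a) + Rabs (ln b).
Proof.
  intros ha hr.
  assert (hmono : forall y z, 0 < y -> y <= z -> ln y <= ln z).
  { intros y z hy [hlt| ->]; [left; now apply ln_increasing|lra]. }
  assert (h1 := hmono a r ha (proj1 hr)). assert (h2 := hmono r b ltac:(lra) (proj2 hr)).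
  unfold Rabs; repeat destruct Rcase_abs; lra.
Qed.

Theorem theorem4p3 :
  forall (I : R -> Prop) (p : R -> R -> R) (mu : R -> R),
  constitutive_laws I p mu ->
  forall c_min c_max rho_min rho_max h1 : R,
  exists C1 C2 : R -> R,
    control_function C1 /\ control_function C2 /\
    forall (J : nat) (x0 c0 rho0 u0 : Z -> R),
      (1 <= J)%nat ->
      initial_data J x0 c0 rho0 u0 ->
      (forall j, I (c0 j)) ->
      minJ J c0 = c_min -> maxJ J c0 = c_max ->
      minJ J rho0 = rho_min -> maxJ J rho0 = rho_max ->
      discrete_H1 J x0 u0 = h1 ->
      exists x c rho u : R -> Z -> R,
        is_solution p mu J x0 c0 rho0 u0 p_infty x c rho u /\
        (forall (T : Rbar) (x' c' rho' u' : R -> Z -> R),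
           Rbar_lt 0 T ->
           is_solution p mu J x0 c0 rho0 u0 T x' c' rho' u' ->
           forall t j, time_dom T t ->
             x' t j = x t j /\ c' t j = c t j /\
             rho' t j = rho t j /\ u' t j = u t j) /\
        (forall t, 0 <= t ->
           (forall j, (0 <= j < Z.of_nat J)%Z ->
              / C1 t <= rho t j <= C1 t /\
              / C2 t * dx x0 j <= dx (x t) j <= C2 t * dx x0 j /\
              c_min <= c t j <= c_max) /\
           mass J x rho t = mass J x rho 0 /\
           energy p mu J x c rho u t = energy p mu J x c rho u 0).
Proof.
  intros I p mu hl c_min c_max rho_min rho_max h1.
  destruct (classic (I c_min /\ I c_max /\ 0 < rho_min /\ rho_min <= rho_max /\ 0 <= h1))
    as [[hI1 [hI2 [hr1 [hr2 hh]]]]|hno].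
  2: {
    (* No initial data have these extrema and this discrete norm. *)
    exists (fun t => 1 * exp (0 + 1 * t)), (fun t => 1 * exp (0 + 1 * t)).
    split; [apply control_function_exp; lra|split; [apply control_function_exp; lra|]].
    intros J x0 c0 rho0 u0 hJ hini hI e1 e2 e3 e4 e5. exfalso. apply hno.
    destruct (minJ_attained J c0 hJ) as [j1 a1]. destruct (maxJ_attained J c0 hJ) as [j2 a2].
    assert (hw := initial_dx_pos J x0 c0 rho0 u0 hJ hini).
    split; [rewrite <- e1, a1; apply hI|split; [rewrite <- e2, a2; apply hI|]].
    split; [rewrite <- e3; apply hini|split].
    - rewrite <- e3, <- e4. apply Rle_trans with (rho0 0%Z).
      + apply minJ_le; auto; apply hini.
      + apply maxJ_ge; auto; apply hini.
    - rewrite <- e5. unfold discrete_H1. rewrite !sumJ_sumn by easy.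
      apply Rplus_le_le_0_compat; apply sumn_nonneg; intros j _;
        (apply Rmult_le_pos; [apply pow2_ge_0|left; apply hw]). }
  destruct (law_constants_exist I p mu c_min c_max hl hI1 hI2) as [nu_min [nu_max [C0 [P1 hc]]]].
  destruct (pressure_bounds I p mu c_min c_max rho_max hl hI1 hI2) as [Q [L [hQ0 [_ hQ]]]]; [lra|].
  set (K := initial_energy_bound rho_max Q h1).
  set (A := nu_max * (Rabs (ln rho_min) + Rabs (ln rho_max)) + 8 * K
            + (nu_max + 2 * K) / (2 * nu_min) * K).
  (* The slope is increased by 1 to make the control functions strictly
     increasing. *)
  set (B := 1 + Rabs (C0 * K + (nu_max + 2 * K) / 2 + P1)).
  assert (hB : 0 < B).
  { unfold B. pose proof (Rabs_pos (C0 * K + (nu_max + 2 * K) / 2 + P1)). lra. }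
  assert (hnm := lc_nu_min _ _ _ _ _ _ _ _ _ hc).
  set (E := fun t => exp (A / nu_min + B / nu_min * t)).
  set (k := 1 + rho_max + / rho_min).
  assert (hk : 0 < / rho_min) by now apply Rinv_0_lt_compat.
  assert (hBn : 0 < B / nu_min) by now apply Rdiv_lt_0_compat.
  exists (fun t => 1 * E t), (fun t => k * E t).
  split; [apply control_function_exp; lra|split; [apply control_function_exp; unfold k; lra|]].
  intros J x0 c0 rho0 u0 hJ hini hI e1 e2 e3 e4 e5.
  assert (hcj : forall j, c_min <= c0 j <= c_max).
  { intros j. rewrite <- e1, <- e2. split; [apply minJ_le|apply maxJ_ge]; auto; apply hini. }
  assert (hrj : forall j, rho_min <= rho0 j <= rho_max).
  { intros j. rewrite <- e3, <- e4. split; [apply minJ_le|apply maxJ_ge]; auto; apply hini. }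
  assert (hw := initial_dx_pos J x0 c0 rho0 u0 hJ hini).
  set (m := cell_mass x0 rho0). set (nu := fun j => mu (c0 j)). set (q := fun j r => p r (c0 j)).
  assert (fl : fluid J m nu q nu_min nu_max C0 P1).
  { now apply (fluid_of_data I p mu hl J x0 c0 rho0 u0 hJ hini c_min c_max). }
  assert (hq : locally_lipschitz_laws q).
  { now apply (locally_lipschitz_of_data I p mu hl c0 c_min c_max). }
  destruct (global_motion J m nu q _ _ _ _ fl hq x0 u0) as [x [u [h0 [hm hloc]]]];
    [apply hini|apply hini|exact hw|].
  assert (hmr : forall j, m j / dx x0 j = rho0 j).
  { intros j. unfold m, cell_mass. field. specialize (hw j). lra. }
  exists x, (fun _ => c0), (fun t j => m j / dx (x t) j), u.
  split; [|split].
  - now apply (motion_solution p mu J x0 c0 rho0 u0 hJ hini).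
  - intros T x' c' rho' u' hT hs t j ht.
    destruct (solution_motion p mu J x0 c0 rho0 u0 hJ hini T x' c' rho' u' hs) as [hcr hm'].
    fold m nu q in hcr, hm'.
    assert (hxu : forall i, x' t i = x t i /\ u' t i = u t i).
    { intros i. assert (ht0 : 0 <= t) by apply ht.
      apply (motion_on_unique J m nu q _ _ _ _ fl hq t x' u' x u ht0); [| | |lra].
      - apply (motion_on_subset _ _ _ _ _ (time_dom T)); [|easy].
        intros s hs'. now apply (time_dom_initial T t).
      - apply (motion_on_subset _ _ _ _ _ (fun s => 0 <= s)); [|easy]. intros s hs'. lra.
      - intros k0. destruct (sol_init _ _ _ _ _ _ _ _ _ _ _ _ hs k0) as [-> [_ [_ ->]]].
        destruct (h0 k0) as [-> ->]. easy. }
    destruct (hcr t j ht) as [-> ->]. destruct (hxu j) as [ex eu].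
    repeat split; auto. unfold dx. now rewrite ex, (proj1 (hxu (j - 1)%Z)).
  - intros t ht. split; [|split].
    + intros j hj. destruct (hloc t ht) as [y [v [hmo hag]]].
      destruct (hm t ht) as [_ [_ [hwt _]]]. specialize (hwt j).
      assert (hdx : forall s i, 0 <= s <= t -> dx (x s) i = dx (y s) i).
      { intros s i hs. unfold dx. destruct (hag s i hs) as [-> _].
        now destruct (hag s (i - 1)%Z hs) as [-> _]. }
      assert (hy0 : forall i, y 0 i = x0 i).
      { intros i. destruct (hag 0 i) as [<- _]; [lra|]. apply h0. }
      assert (hv0 : forall i, v 0 i = u0 i).
      { intros i. destruct (hag 0 i) as [_ <-]; [lra|]. apply h0. }
      assert (hdy0 : forall i, dx (y 0) i = dx x0 i) by (intros i; unfold dx; now rewrite !hy0).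
      assert (hK : kinetic J m (v 0) + potential J m q (y 0) + sumn J m <= K /\ sumn J m <= K).
      { apply (initial_energy_le J m nu q _ _ _ _ fl); auto; try lra.
        - apply (mo_x_periodic _ _ _ _ _ _ _ hmo); lra.
        - intros i. now rewrite hdy0.
        - intros i. rewrite hdy0, hmr. apply hrj.
        - intros i s hs. eapply Rle_trans; [apply Rle_abs|]. now apply (hQ (c0 i) s s).
        - rewrite <- e5. unfold discrete_H1. rewrite !sumJ_sumn by easy.
          f_equal; apply sumn_ext; intros i _; unfold Du; rewrite hdy0, !hv0; reflexivity. }
      assert (hlog := log_density_le J m nu q _ _ _ _ fl t K y v t j hmo ltac:(lra) hj
        (proj1 hK) (proj2 hK)).
      rewrite hdy0, hmr, <- hdx in hlog by lra.
      assert (hrho : 0 < m j / dx (x t) j).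
      { apply Rdiv_lt_0_compat; [apply fl|easy]. }
      assert (hnu := fl_nu _ _ _ _ _ _ _ _ fl j).
      assert (hl0 : Rabs (nu j * ln (rho0 j)) <= nu_max * (Rabs (ln rho_min) + Rabs (ln rho_max))).
      { rewrite Rabs_mult, (Rabs_pos_eq (nu j)) by lra.
        apply Rmult_le_compat; [lra|apply Rabs_pos|lra|now apply ln_bounded]. }
      assert (hBt : (C0 * K + (nu_max + 2 * K) / 2 + P1) * t <= B * t).
      { apply Rmult_le_compat_r; [easy|]. unfold B.
        pose proof (Rle_abs (C0 * K + (nu_max + 2 * K) / 2 + P1)). lra. }
      assert (hln : Rabs (ln (m j / dx (x t) j)) <= A / nu_min + B / nu_min * t).
      { apply Rmult_le_reg_l with nu_min; [easy|].
        replace (nu_min * (A / nu_min + B / nu_min * t)) with (A + B * t) by (field; lra).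
        apply Rle_trans with (Rabs (nu j * ln (m j / dx (x t) j))); [|unfold A; lra].
        rewrite Rabs_mult, (Rabs_pos_eq (nu j)) by lra.
        apply Rmult_le_compat_r; [apply Rabs_pos|lra]. }
      destruct (exp_bounds_of_log _ _ hrho hln) as [b1 b2]. fold (E t) in b1, b2.
      assert (hE : 0 < E t) by apply exp_pos.
      rewrite Rmult_1_l. split; [easy|split; [|apply hcj]].
      specialize (hw j). specialize (hrj j).
      assert (hx : dx (x t) j * (m j / dx (x t) j) = rho0 j * dx x0 j).
      { unfold m, cell_mass. field. lra. }
      set (r := m j / dx (x t) j) in *.
      split.
      * apply Rmult_le_reg_l with (k * E t); [apply Rmult_lt_0_compat; unfold k; lra|].
        rewrite <- Rmult_assoc, Rinv_r, Rmult_1_l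
          by (apply Rgt_not_eq, Rmult_lt_0_compat; unfold k; lra).
        apply Rle_trans with (/ rho_min * (dx (x t) j * E t)).
        -- apply Rmult_le_reg_l with rho_min; [easy|].
           rewrite <- Rmult_assoc, Rinv_r, Rmult_1_l by lra.
           apply Rle_trans with (dx (x t) j * r).
           ++ rewrite hx. apply Rmult_le_compat_r; lra.
           ++ apply Rmult_le_compat_l; lra.
        -- rewrite Rmult_assoc, (Rmult_comm (E t)).
           apply Rmult_le_compat_r; [apply Rmult_le_pos; lra|unfold k; lra].
      * apply Rle_trans with (rho_max * E t * dx x0 j).
        -- apply Rmult_le_reg_r with r; [easy|]. rewrite hx.
           apply Rle_trans with (rho_max * dx x0 j * 1).
           ++ rewrite Rmult_1_r. apply Rmult_le_compat_r; lra.
           ++ replace (rho_max * E t * dx x0 j * r) with (rho_max * dx x0 j * (E t * r)) by ring.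
              apply Rmult_le_compat_l; [apply Rmult_le_pos; lra|].
              rewrite <- (Rinv_r (E t)) by lra. apply Rmult_le_compat_l; lra.
        -- apply Rmult_le_compat_r; [lra|]. apply Rmult_le_compat_r; [lra|unfold k; lra].
    + unfold m. rewrite !mass_of_motion; auto.
      * now apply hm.
      * apply hm; easy.
    + destruct (hloc t ht) as [y [v [hmo hag]]].
      assert (hmo0 : motion J m nu q 0 y v).
      { destruct hmo as [g1 g2 g3 g4 g5]. split; intros; [apply g1|apply g2|apply g3|apply g4|apply g5]; lra. }
      unfold m. rewrite (energy_of_motion p mu J x0 c0 rho0 hJ nu_min nu_max C0 P1 t x u y v); auto.
      rewrite (energy_of_motion p mu J x0 c0 rho0 hJ nu_min nu_max C0 P1 0 x u y v); auto; [lra|].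
      intros s i hs. apply hag. lra.
Qed.
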